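(* Let $F \in \mathbb{Z}[x,y]$ be a polynomial of total degree $6$, and let $F_6$ be its homogeneous part of degree $6$. Suppose that, over an algebraic closure $\overline{\mathbb{Q}}$ of $\mathbb{Q}$, $F_6$ is divisible by the fourth power of a non-constant binary form but is not divisible by the fifth power of any non-constant binary form. Then $F$ is not arithmetically complete.
   Context: A polynomial $F(x,y) \in \mathbb{Z}[x,y]$ is called arithmetically complete if there exist a positive integer $D_1$ and an integer $D_2$ such that $F(\mathbb{Z}^2) = D_1 \mathbb{Z}_{\geq 0} + D_2 = \{D_1 m + D_2 : m \in \mathbb{Z}, m \geq 0\}$. A binary form is a homogeneous polynomial in two variables. *)

(* Defs.v *)
From HB Require Import structures.
From mathcomp Require Import all_boot all_order all_algebra all_field.
From mathcomp Require Export mpoly.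

Set Implicit Arguments.
Unset Strict Implicit.
Unset Printing Implicit Defensive.

Import Order.TTheory GRing.Theory Num.Theory.
Local Open Scope ring_scope.

Definition eval2 (F : {mpoly int[2]}) (x y : int) : int :=
  F.@[tnth [tuple x; y]].

Definition arithmetically_complete (F : {mpoly int[2]}) : Prop :=
  exists D1 D2 : int, 0 < D1 /\
    forall n : int,
      (exists x y : int, eval2 F x y = n) <->
      (exists m : int, 0 <= m /\ n = D1 * m + D2).

(* As msize is 1 + the total degree (and 0 for the zero polynomial), the size
   condition says that H has positive degree; in particular H != 0. *)
Definition nonconstant_binary_form (K : comNzRingType) (H : {mpoly K[2]}) :
    Prop :=
  H \is homog mdeg /\ (1 < msize H)%N.

Definition mdivides (K : comNzRingType) (n : nat) (G P : {mpoly K[n]}) : Prop :=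
  exists Q : {mpoly K[n]}, P = Q * G.

Definition divisible_by_form_power (K : comNzRingType) (k : nat)
    (P : {mpoly K[2]}) : Prop :=
  exists H : {mpoly K[2]}, nonconstant_binary_form H /\ mdivides (H ^+ k) P.

Definition homogeneous_part (R : nzRingType) (d : nat) (F : {mpoly R[2]}) :
    {mpoly R[2]} :=
  pihomog mdeg d F.

(* algC, the field of algebraic numbers, is the algebraic closure of rat. *)
Definition to_algC (P : {mpoly int[2]}) : {mpoly algC[2]} :=
  map_mpoly (intr : int -> algC) P.

(* Main.v *)
Require Import Defs.
From HB Require Import structures.
From mathcomp Require Import all_boot all_order all_algebra all_field.
From mathcomp Require Import mpoly.
From mathcomp Require Import zify ring.

Set Implicit Arguments.
Unset Strict Implicit.
Unset Printing Implicit Defensive.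

Import Order.TTheory GRing.Theory Num.Theory.
Local Open Scope ring_scope.

(* Suppose that the values of F form the progression. Since F is bounded below
   and takes a positive proportion of the integers, it is enough to show that
   at most O(N^(3/4)) integers up to N are values of F. This is clear for the
   values at points with x^2 + y^4 <= C (F(x,y) + C), as well as for the values
   on a line, on which F is a constant or of even degree.

   The fourfold root of F_6 is rational, because its minimal polynomial divides
   F_6(x,1) to the fourth power; a unimodular substitution then gives
   F_6 = y^4 (a x^2 + b x y + c y^2) with a <> 0. Boundedness from below on
   lines with fixed y gives F = e x^4 + f_3(y) x^3 + f_2(y) x^2 + f_1(y) x + f_0(y)
   with deg f_3 <= 2, and with x of weight 2 and y of weight 1 the leading part
   x^2 (e x^2 + g x y^2 + a y^4) is nonnegative. Away from its zeros x = 0 and,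
   if g^2 = 4 a e > 0, the parabola 2 e x + g y^2 = 0, F dominates
   x^2 + y^4. Near x = 0, F behaves like y^4 (a x^2 + b x y + c y^2), which is
   nonnegative; it either dominates, or is y^4 times a square, in which case
   a shift of x along each residue class of y modulo 2 a reduces the strip to
   finitely many lines and points at which F >= y^4 x^2 / 2. A shift along the
   parabola reduces its neighbourhood to the strip x = 0. *)

(** * Sparse sets of integers *)

(** With N = K^4 this is the bound O(N^(3/4)), free of fractional powers; the list may contain
    further integers. *)
Definition sparse (S : int -> Prop) : Prop :=
  exists C : nat, forall K : nat, (0 < K)%N ->
    exists L : seq int, (size L <= C * K ^ 3)%N /\
      forall v, S v -> v <= K%:Z ^+ 4 -> v \in L.

Lemma sparse_sub (S T : int -> Prop) :
  (forall v, S v -> T v) -> sparse T -> sparse S.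
Proof.
move=> sub [C hC]; exists C => K /hC [L [sL hL]].
by exists L; split=> // v /sub; apply: hL.
Qed.

Lemma sparse_or (S T : int -> Prop) :
  sparse S -> sparse T -> sparse (fun v => S v \/ T v).
Proof.
move=> [C hC] [D hD]; exists (C + D)%N => K K0.
have [L [sL hL]] := hC K K0; have [M [sM hM]] := hD K K0.
exists (L ++ M); split; first by rewrite size_cat mulnDl leq_add.
by move=> v [/hL h|/hM h] /h vL; rewrite mem_cat vL ?orbT.
Qed.

Lemma sparse_bigor (S : nat -> int -> Prop) n :
  (forall i, (i < n)%N -> sparse (S i)) ->
  sparse (fun v => exists2 i, (i < n)%N & S i v).
Proof.
elim: n => [_|n IHn hS]; first by exists 0%N => K _; exists [::]; split=> // v [].
apply: (sparse_sub _ (sparse_or (IHn _) (hS n (ltnSn n)))).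
  move=> v [i]; rewrite ltnS leq_eqVlt => /orP[/eqP -> |lt_in]; first by right.
  by left; exists i.
by move=> i lt_in; apply: hS; apply: ltnW.
Qed.

Definition centered_range (b : nat) : seq int :=
  [seq i%:Z - b%:Z | i <- iota 0 b.*2.+1].

Lemma size_centered_range b : size (centered_range b) = b.*2.+1.
Proof. by rewrite size_map size_iota. Qed.

Lemma mem_centered_range b (x : int) : `|x| <= b%:Z -> x \in centered_range b.
Proof.
move=> hx; apply/mapP; exists (absz (x + b%:Z)); first by rewrite mem_iota; lia.
lia.
Qed.

Lemma sparse_bigor_int (S : int -> int -> Prop) (B : int) :
  (forall j, sparse (S j)) -> sparse (fun v => exists2 j, `|j| <= B & S j v).
Proof.
move=> hS.
apply: (@sparse_sub _ (fun v => exists2 i : nat, (i < (absz B).*2.+1)%N &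
   S (i%:Z - (absz B)%:Z) v)); last by apply: sparse_bigor.
move=> v [j hj Sj]; exists (absz (j + (absz B)%:Z)); first lia.
by have -> : ((absz (j + (absz B)%:Z))%:Z - (absz B)%:Z) = j by lia.
Qed.

Lemma PoszX (m n : nat) : (m ^ n)%N%:Z = m%:Z ^+ n.
Proof. by elim: n => // n IHn; rewrite expnS PoszM IHn exprS. Qed.

(** Where G <= K^4, the hypothesis confines x to O(K^2) and y to O(K), which leaves O(K^3) points
    and at most as many values. *)
Lemma sparse_box (P : int -> int -> Prop) (G : int -> int -> int) (C : int) :
  0 <= C -> (forall x y, P x y -> x ^+ 2 + y ^+ 4 <= C * (G x y + C)) ->
  sparse (fun v => exists x y, P x y /\ v = G x y).
Proof.
case: C => // c _ hG; exists ((c.*2 + 3) ^ 2)%N => K K0.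
(* The half-sides come from c (K^4 + c) <= (c + 1)^2 K^4. A range with b = (c + 1) K^i has 2 b + 1
   <= (2 c + 3) K^i elements, whence the constant (2 c + 3)^2. *)
exists [seq G x y | x <- centered_range (c.+1 * K ^ 2),
                    y <- centered_range (c.+1 * K)]; split.
  rewrite size_allpairs !size_centered_range (expnS K 2) mulnA.
  have -> : ((c.*2 + 3) ^ 2 * K * K ^ 2 =
            ((c.*2 + 3) * K ^ 2) * ((c.*2 + 3) * K))%N by ring.
  by apply: leq_mul; nia.
move=> _ [x [y [/hG hxy ->]]] leK; apply: allpairs_f; apply: mem_centered_range.
  rewrite -(@ler_pXn2r _ 2) ?nnegrE ?normr_ge0 // real_normK ?num_real //.
  have y4 : 0 <= y ^+ 4 by rewrite exprn_even_ge0.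
  have K1 : 1 <= (K ^ 4)%N%:Z by rewrite lez_nat expn_gt0 K0.
  have -> : (c.+1 * K ^ 2)%N%:Z ^+ 2 = (c%:Z + 1) ^+ 2 * K%:Z ^+ 4.
    by rewrite PoszM PoszX exprMn -exprM -addn1 PoszD.
  rewrite PoszX in K1; move: K1 leK hxy; move: (K%:Z ^+ 4) (y ^+ 4) y4 => k z.
  nia.
rewrite -(@ler_pXn2r _ 4) ?nnegrE ?normr_ge0 // -normrX ger0_norm ?exprn_even_ge0 //.
have x2 : 0 <= x ^+ 2 by rewrite exprn_even_ge0.
have K1 : 1 <= (K ^ 4)%N%:Z by rewrite lez_nat expn_gt0 K0.
rewrite PoszM exprMn; rewrite PoszX in K1.
have c4 : c%:Z * (c%:Z + 1) <= c.+1%:Z ^+ 4.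
  have -> : c.+1%:Z = c%:Z + 1 by lia.
  by move: (c%:Z) (le0z_nat c) => d d0; rewrite !exprS expr0; nia.
have c0 : 0 <= c%:Z by [].
move: K1 leK hxy; move: (K%:Z ^+ 4) (x ^+ 2) x2 => k z z0 k1 kG h.
apply: le_trans (_ : c%:Z * (c%:Z + 1) * k <= _); last by apply: ler_wpM2r => //; lia.
nia.
Qed.

(** * Growth of integer polynomials in one variable *)

(** A nonzero integer has absolute value at least 1, so every lower power is at most |y|^n and the
    absolute values of the lower coefficients can simply be added. *)
Lemma poly_lead_approx (p : {poly int}) n : (size p <= n.+2)%N ->
  exists2 C : int, 0 <= C &
    forall y : int, y != 0 -> `|p.[y] - p`_n.+1 * y ^+ n.+1| <= C * `|y| ^+ n.
Proof.
move=> sp; exists (\sum_(i < n.+1) `|p`_i|); first by apply: sumr_ge0.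
move=> y y0; rewrite (horner_coef_wide _ sp) big_ord_recr /= addrK.
apply: le_trans (ler_norm_sum _ _ _) _; rewrite mulr_suml; apply: ler_sum => i _.
rewrite normrM normrX; apply: ler_wpM2l => //.
by apply: ler_weXn2l; [lia | case: i].
Qed.

Lemma poly_norm_bound (p : {poly int}) n : (size p <= n.+1)%N ->
  exists2 C : int, 0 <= C & forall y : int, y != 0 -> `|p.[y]| <= C * `|y| ^+ n.
Proof.
move=> sp; exists (\sum_(i < n.+1) `|p`_i|); first by apply: sumr_ge0.
move=> y y0; rewrite (horner_coef_wide _ sp).
apply: le_trans (ler_norm_sum _ _ _) _; rewrite mulr_suml; apply: ler_sum => i _.
rewrite normrM normrX; apply: ler_wpM2l => //.
by apply: ler_weXn2l; [lia | case: i].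
Qed.

Lemma coef_ge0_of_lower_bound (p : {poly int}) n (D : int) :
  (size p <= n.+2)%N -> (forall y, D <= p.[y]) -> 0 <= p`_n.+1.
Proof.
move=> sp hD; rewrite leNgt; apply/negP => c0.
have [C C0 hC] := poly_lead_approx sp.
(* A negative coefficient would give p(y) <= y^n (C - y) = - (|D| + 1) y^n < D at this point. *)
pose y : int := C + `|D| + 1.
have y1 : 1 <= y by rewrite /y; lia.
have := hC y ltac:(lia); rewrite (ger0_norm (_ : 0 <= y)); last lia.
move: (hD y); rewrite exprS; set P := p.[y].
have yn : 1 <= y ^+ n by rewrite exprn_ege1.
move: (p`_n.+1) c0 (y ^+ n) yn => c c0 z z1 DP.
rewrite ler_norml => /andP[_ h].
have : P <= z * (C - y) by nia.
rewrite /y; nia.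
Qed.

Lemma coef_comp_linear (p : {poly int}) n (A B : int) :
  (size p <= n.+1)%N ->
  (size (p \Po (A *: 'X + B%:P)) <= n.+1)%N /\
  (p \Po (A *: 'X + B%:P))`_n = p`_n * A ^+ n.
Proof.
elim: n p => [|n IHn] p sp.
  by rewrite (size1_polyC sp) comp_polyC !coefC /= expr0 mulr1 size_polyC_leq1.
elim/poly_ind: p sp => [_|q c _ sp]; first by rewrite comp_poly0 size_poly0 !coef0 mul0r.
have sq : (size q <= n.+1)%N.
  have := sp; rewrite size_MXaddC; case: ifP => [/andP[/eqP -> _]|_] //.
  by rewrite size_poly0.
have [sc cc] := IHn _ sq.
rewrite comp_polyD comp_polyM comp_polyX comp_polyC mulrDr -scalerAr.
set r := q \Po _ in sc cc *.
have s0 i : (n.+1 <= i)%N -> r`_i = 0 by move=> ni; rewrite nth_default // (leq_trans sc).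
split.
  apply/leq_sizeP => j lt_nj; rewrite !coefD coefZ coefMX coefMC coefC.
  by case: j lt_nj => // j lt_nj /=; rewrite !s0 // ?mulr0 ?mul0r ?addr0 // ltnW.
rewrite !coefD coefZ !coefMX coefMC !coefC /= cc (s0 n.+1) // mul0r !addr0.
by rewrite mulrCA exprS.
Qed.

(** The substitution of -y for y keeps the lower bound and changes the sign of a coefficient of odd
    degree, so both signs are nonnegative. *)
Lemma coef_odd_of_lower_bound (p : {poly int}) n (D : int) :
  odd n -> (size p <= n.+1)%N -> (forall y, D <= p.[y]) -> p`_n = 0.
Proof.
case: n => // n odn sp hD; apply/eqP; rewrite eq_le (coef_ge0_of_lower_bound sp hD) andbT.
have [sq cq] := coef_comp_linear (-1) 0 sp.
have := coef_ge0_of_lower_bound (D := D) sq; rewrite cq.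
rewrite -signr_odd odn expr1 mulrN1 oppr_ge0; apply=> y; rewrite horner_comp; exact: hD.
Qed.

(** Used with w = |y|, z = |y|^n, c the leading coefficient and P = p(y): beyond |y| = 2 C the error
    C w z is at most half of the leading term. *)
Fact growth_arith (z c w C P : int) :
  1 <= z -> 1 <= c -> 0 <= w -> 2 * C < w ->
  - (C * (w * z)) <= P - c * (w * (w * z)) -> w * w <= 2 * P.
Proof.
move=> z1 c1 w0 wC h.
have t0 : 0 <= w * z by rewrite mulr_ge0 // (le_trans _ z1).
have h2 : w * w <= w * (w * z) by rewrite ler_wpM2l // ler_peMr.
have h3 : w * (w * z) <= c * (w * (w * z)) by rewrite ler_peMl // mulr_ge0.
have h4 : 2 * (C * (w * z)) <= w * (w * z) by rewrite mulrA ler_wpM2r // ltW.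
lia.
Qed.

Lemma poly_growth_of_lower_bound (p : {poly int}) (D : int) :
  (1 < size p)%N -> (forall y, D <= p.[y]) ->
  exists2 C : int, 0 <= C & forall y : int, y ^+ 2 <= C * (p.[y] + C).
Proof.
(* Degree 1 is odd and therefore excluded by the lower bound, so the degree is at least 2. *)
move=> s1 hD; have [n sp] : exists n, size p = n.+3.
  have : size p != 2%N; last by case: (size p) s1 => [|[|[|n]]] //; exists n.
  apply/eqP => s2; have := @coef_odd_of_lower_bound p 1 D isT; rewrite s2 => /(_ isT hD).
  by move/eqP; have := lead_coefE p; rewrite s2 /= => <-; rewrite lead_coef_eq0 -size_poly_eq0 s2.
have c1 : 1 <= p`_n.+2.
  have c0 := @coef_ge0_of_lower_bound p n.+1 D _ hD.
  have : p`_n.+2 != 0 by have := lead_coefE p; rewrite sp /= => <-; rewrite lead_coef_eq0 -size_poly_eq0 sp.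
  by move: c0; rewrite sp; lia.
have [C C0 hC] := @poly_lead_approx p n.+1 (eq_leq sp).
(* For |y| <= 2 C the term 4 C^2 bounds y^2 while |D| + 2 keeps the second factor positive; for
   larger |y| the bound is y^2 <= 2 p(y). *)
exists (4 * C ^+ 2 + `|D| + 2) => [|y]; first by rewrite !addr_ge0 ?mulr_ge0 ?exprn_ge0.
have [yC|yC] := lerP `|y| (2 * C).
  have : y ^+ 2 <= 4 * C ^+ 2.
    by rewrite -real_normK ?num_real // !expr2; move: `|y| (normr_ge0 y) yC => w; nia.
  have := hD y; move: (p.[y]) (y ^+ 2) => P z DP; rewrite expr2; nia.
have := hC y ltac:(lia); rewrite ler_norml => /andP[h _].
have od : ~~ odd n.
  apply/negP => od; have := @coef_odd_of_lower_bound p n.+2 D.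
  by rewrite /= negbK od sp => /(_ isT (leqnn _) hD) e; rewrite e in c1.
have yn : y ^+ n.+2 = `|y| ^+ n.+2.
  by rewrite -normrX ger0_norm // exprn_even_ge0 //= negbK.
have zn : 1 <= `|y| ^+ n by rewrite exprn_ege1 //; lia.
have h1 : `|y| ^+ 2 <= 2 * p.[y].
  by move: h; rewrite yn !exprS expr0 mulr1; apply: growth_arith.
rewrite -(real_normK (num_real y)); have := exprn_ge0 2 (normr_ge0 y).
move: (`|y| ^+ 2) (p.[y]) (C ^+ 2) (exprn_ge0 2 C0) h1 => t P c; nia.
Qed.

(** A nonconstant polynomial bounded below grows at least quadratically, so the box lemma applies
    with its second variable set to 0. *)
Lemma sparse_poly (p : {poly int}) (D : int) :
  (forall y, D <= p.[y]) -> sparse (fun v => exists y, v = p.[y]).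
Proof.
move=> hD; have [s1|s1] := leqP (size p) 1.
  exists 1%N => K K0; exists [:: p`_0]; split; first by rewrite mul1n expn_gt0 K0.
  by move=> _ [y ->] _; rewrite (size1_polyC s1) hornerC coefC inE.
have [C C0 hC] := poly_growth_of_lower_bound s1 hD.
apply: (@sparse_sub _ (fun v => exists x y, y = 0 /\ v = (fun u _ => p.[u]) x y)).
  by move=> v [y ->]; exists y, 0.
by apply: (sparse_box C0) => x _ ->; rewrite expr0n addr0.
Qed.

Lemma sparse_not_progression (S : int -> Prop) (D1 D2 : int) :
  0 < D1 -> sparse S -> ~ (forall m, 0 <= m -> S (D1 * m + D2)).
Proof.
(* This K gives d1 C K^3 + |D2| <= K^4, so the first C K^3 + 1 terms of the progression are at most
   K^4, too many for the list. *)
case: D1 => // d1 d0 [C hC] hS; pose K := (d1 * C + `|D2| + 1)%N.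
have K0 : (0 < K)%N by rewrite /K addn1.
have [L [sL hL]] := hC K K0.
pose s := [seq d1%:Z * i%:Z + D2 | i <- iota 0 (C * K ^ 3).+1].
have : (size s <= size L)%N.
  apply: uniq_leq_size.
    rewrite map_inj_in_uniq ?iota_uniq // => i j _ _ /addIr /mulfI h.
    by have [] : i%:Z = j%:Z by apply: h; lia.
  move=> _ /mapP[i + ->]; rewrite mem_iota add0n ltnS => /andP[_ hi].
  apply: hL; first by apply: hS.
  have : (d1 * i + `|D2| <= K ^ 4)%N; last by rewrite -PoszX; lia.
  rewrite (expnS K 3) {1}/K; have : (0 < K ^ 3)%N by rewrite expn_gt0 K0.
  move: (K ^ 3)%N hi => k hi k0; nia.
by rewrite size_map size_iota leqNgt ltnS sL.
Qed.

(** * Polynomial functions with a degree bound and a marked coefficient *)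

(** The coefficient of degree n is recorded even when it vanishes, so that top coefficients add and
    multiply without conditions on the actual degrees; once it is known to be 0, [polyf_narrow]
    lowers the bound. *)
Definition polyf (n : nat) (c : int) (f : int -> int) : Prop :=
  exists p : {poly int}, [/\ (size p <= n.+1)%N, p`_n = c & f =1 horner p].

Lemma polyf_eq n c d f g : polyf n c f -> c = d -> f =1 g -> polyf n d g.
Proof. by move=> [p [sp cp fp]] <- fg; exists p; split=> // x; rewrite -fg. Qed.

Lemma polyf_cst (c : int) : polyf 0 c (fun=> c).
Proof. by exists c%:P; split=> [||x]; rewrite ?size_polyC_leq1 ?coefC ?hornerC. Qed.

Lemma polyf_id : polyf 1 1 id.
Proof. by exists 'X; split=> [||x]; rewrite ?size_polyX ?coefX ?hornerX. Qed.

Lemma polyfD n c d f g :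
  polyf n c f -> polyf n d g -> polyf n (c + d) (fun y => f y + g y).
Proof.
move=> [p [sp <- fp]] [q [sq <- fq]]; exists (p + q); split=> [||x].
- by rewrite (leq_trans (size_polyD _ _)) // geq_max sp.
- by rewrite coefD.
- by rewrite hornerD fp fq.
Qed.

Lemma coefM_top (R : comNzRingType) (p q : {poly R}) m n :
  (size p <= m.+1)%N -> (size q <= n.+1)%N -> (p * q)`_(m + n) = p`_m * q`_n.
Proof.
move=> sp sq; rewrite coefM (bigD1 (inord m)) //= inordK ?ltnS ?leq_addr // addKn.
rewrite big1 ?addr0 // => i; rewrite -val_eqE /= inordK ?ltnS ?leq_addr // => ne_im.
have [lt_mi|le_im] := ltnP m i; first by rewrite nth_default ?mul0r // (leq_trans sp).
by rewrite [q`__]nth_default ?mulr0 // (leq_trans sq) //; case: i ne_im le_im => /=; lia.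
Qed.

Lemma polyfM m n c d f g :
  polyf m c f -> polyf n d g -> polyf (m + n) (c * d) (fun y => f y * g y).
Proof.
move=> [p [sp <- fp]] [q [sq <- fq]]; exists (p * q); split=> [||x].
- by rewrite (leq_trans (size_polyMleq _ _)) //; lia.
- exact: coefM_top.
- by rewrite hornerM fp fq.
Qed.

Lemma polyf_scale n c k f : polyf n c f -> polyf n (k * c) (fun y => k * f y).
Proof. exact: (polyfM (polyf_cst k)). Qed.

Lemma polyf_wide n c f : polyf n c f -> polyf n.+1 0 f.
Proof. by case=> p [sp _ fp]; exists p; split; rewrite ?nth_default // ltnW. Qed.

Lemma polyf_narrow n f : polyf n.+1 0 f -> exists c, polyf n c f.
Proof.
case=> p [sp p0 fp]; exists p`_n, p; split=> //; apply/leq_sizeP => j.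
by rewrite leq_eqVlt => /orP[/eqP <- //|lt_nj]; rewrite nth_default // (leq_trans sp).
Qed.

Lemma polyf_affine n c f A j :
  polyf n c f -> polyf n (c * A ^+ n) (fun k => f (A * k + j)).
Proof.
case=> p [sp <- fp]; have [sq cq] := coef_comp_linear A j sp.
by eexists; split; [exact: sq | exact: cq | move=> x; rewrite horner_comp !hornerE fp].
Qed.

Lemma polyf_bound n c f : polyf n c f ->
  exists2 C : int, 0 <= C & forall y : int, y != 0 -> `|f y| <= C * `|y| ^+ n.
Proof.
by case=> p [/poly_norm_bound[C C0 hC] _ fp]; exists C => // y /hC; rewrite fp.
Qed.

Lemma polyf_approx n c f : polyf n.+1 c f ->
  exists2 C : int, 0 <= C &
    forall y : int, y != 0 -> `|f y - c * y ^+ n.+1| <= C * `|y| ^+ n.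
Proof.
case=> p [/poly_lead_approx[C C0 hC] <- fp]; exists C => // y.
by rewrite fp; apply: hC.
Qed.

Lemma polyf_lead_ge0 n c f (D : int) :
  polyf n.+1 c f -> (forall y, D <= f y) -> 0 <= c.
Proof.
case=> p [sp <- fp] hD; apply: (coef_ge0_of_lower_bound sp) => y.
by rewrite -fp; apply: hD.
Qed.

Lemma polyf_odd_lead n c f (D : int) :
  odd n -> polyf n c f -> (forall y, D <= f y) -> c = 0.
Proof.
move=> on [p [sp <- fp]] hD; apply: (coef_odd_of_lower_bound on sp) => y.
by rewrite -fp; apply: hD.
Qed.

(** * Quartics in u and their shifts *)

(** The coefficient of u^4 is a constant because boundedness from below removes its dependence on y,
    as shown in [sparse_sextic]. *)
Definition quartic (f0 f1 f2 f3 : int -> int) (e : int) (u y : int) : int :=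
  f0 y + f1 y * u + f2 y * u ^+ 2 + f3 y * u ^+ 3 + e * u ^+ 4.

Definition bounded_below (G : int -> int -> int) : Prop :=
  exists D : int, forall u y, D <= G u y.

(* A shift [u = X + h k], combined with the restriction of [y] to a residue
   class; the degrees of the coefficients decrease in steps of [deg h]. *)
Lemma quartic_transform d m c0 c1 c2 c3 c4 eta f0 f1 f2 f3 e h (A j : int) :
  polyf (m + (m + (m + (m + d)))) c0 f0 -> polyf (m + (m + (m + d))) c1 f1 ->
  polyf (m + (m + d)) c2 f2 -> polyf (m + d) c3 f3 ->
  polyf d c4 (fun=> e) -> polyf m eta h ->
  let C0 := c0 * A ^+ (m + (m + (m + (m + d)))) in
  let C1 := c1 * A ^+ (m + (m + (m + d))) in
  let C2 := c2 * A ^+ (m + (m + d)) in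
  let C3 := c3 * A ^+ (m + d) in
  exists g0 g1 g2 g3 : int -> int,
  [/\ polyf (m + (m + (m + (m + d))))
        (C0 + eta * C1 + eta * (eta * C2) + eta * (eta * (eta * C3))
         + eta * (eta * (eta * (eta * c4)))) g0,
      polyf (m + (m + (m + d)))
        (C1 + 2 * (eta * C2) + 3 * (eta * (eta * C3))
         + 4 * (eta * (eta * (eta * c4)))) g1,
      polyf (m + (m + d)) (C2 + 3 * (eta * C3) + 6 * (eta * (eta * c4))) g2,
      polyf (m + d) (C3 + 4 * (eta * c4)) g3 &
      forall X k, quartic g0 g1 g2 g3 e X k = quartic f0 f1 f2 f3 e (X + h k) (A * k + j)].
Proof.
move=> /(polyf_affine A j) h0 /(polyf_affine A j) h1 /(polyf_affine A j) h2.
move=> /(polyf_affine A j) h3 h4 hh C0 C1 C2 C3.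
do 4![eexists]; split.
- exact: polyfD (polyfD (polyfD (polyfD h0 (polyfM hh h1)) (polyfM hh (polyfM hh h2)))
    (polyfM hh (polyfM hh (polyfM hh h3)))) (polyfM hh (polyfM hh (polyfM hh (polyfM hh h4)))).
- exact: polyfD (polyfD (polyfD h1 (polyf_scale 2 (polyfM hh h2)))
    (polyf_scale 3 (polyfM hh (polyfM hh h3))))
    (polyf_scale 4 (polyfM hh (polyfM hh (polyfM hh h4)))).
- exact: polyfD (polyfD h2 (polyf_scale 3 (polyfM hh h3))) (polyf_scale 6 (polyfM hh (polyfM hh h4))).
- exact: polyfD h3 (polyf_scale 4 (polyfM hh h4)).
by move=> X k; rewrite /quartic; ring.
Qed.

(** * The strip around u = 0 *)

(** A neighbourhood of the line u = 0 when u has weight 2 and y has weight 1; it narrows as M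
    grows. *)
Definition strip (M : int) (G : int -> int -> int) (v : int) : Prop :=
  exists u y, [/\ M * `|u| <= y ^+ 2, M <= `|y| & v = G u y].

Lemma sparse_line f0 f1 f2 f3 e n0 n1 n2 n3 c0 c1 c2 c3 u :
  polyf n0 c0 f0 -> polyf n1 c1 f1 -> polyf n2 c2 f2 -> polyf n3 c3 f3 ->
  bounded_below (quartic f0 f1 f2 f3 e) ->
  sparse (fun v => exists y, v = quartic f0 f1 f2 f3 e u y).
Proof.
move=> [p0 [_ _ h0]] [p1 [_ _ h1]] [p2 [_ _ h2]] [p3 [_ _ h3]] [D hD].
pose p := p0 + p1 * u%:P + p2 * (u ^+ 2)%:P + p3 * (u ^+ 3)%:P + (e * u ^+ 4)%:P.
have pE y : quartic f0 f1 f2 f3 e u y = p.[y].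
  by rewrite /quartic !hornerE h0 h1 h2 h3.
apply: (sparse_sub _ (@sparse_poly p D _)) => [v [y ->]|y]; first by exists y.
by rewrite -pE.
Qed.

(** Here v = |u| and w = |y|. Each error monomial is compared with w^4 v^2 by trading a factor w for
    M, or a factor w^2 for M v or v. *)
Fact powers_dominated (M v w : int) : 1 <= M -> 0 <= v -> M <= w -> M * v <= w ^+ 2 ->
  [/\ M * (w ^+ 3 * v ^+ 2) <= w ^+ 4 * v ^+ 2,
      M * (w ^+ 2 * v ^+ 3) <= w ^+ 4 * v ^+ 2 &
      M * v ^+ 4 <= w ^+ 4 * v ^+ 2].
Proof.
move=> M1 v0 Mw Mv; have w0 : 0 <= w by lia.
have le_vw : v <= w ^+ 2 by apply: le_trans Mv; rewrite ler_peMl.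
have h3 : M * (w ^+ 2 * v ^+ 3) <= w ^+ 4 * v ^+ 2.
  have -> : M * (w ^+ 2 * v ^+ 3) = M * v * (w ^+ 2 * v ^+ 2) by ring.
  have -> : w ^+ 4 * v ^+ 2 = w ^+ 2 * (w ^+ 2 * v ^+ 2) by ring.
  by rewrite ler_wpM2r // mulr_ge0 ?exprn_ge0.
split=> //.
  rewrite mulrA ler_wpM2r ?exprn_ge0 // (exprS w 3).
  by rewrite ler_wpM2r ?exprn_ge0.
apply: le_trans h3; rewrite ler_wpM2l ?(le_trans ler01) // (exprS v 3).
by rewrite ler_wpM2r ?exprn_ge0.
Qed.

(** The main part is t0 + t1 u + t2 u^2. The error of its constant term stays separate because it is
    of order |y|^4 in one application and |y|^5 in the other. *)
Fact quartic_error (x0 x1 x2 x3 t0 t1 t2 e u y C : int) :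
  0 <= C -> `|e| <= C -> `|x3| <= C * `|y| ^+ 2 -> `|x2 - t2| <= C * `|y| ^+ 3 ->
  `|x1 - t1| <= C * `|y| ^+ 4 ->
  `|x0 + x1 * u + x2 * u ^+ 2 + x3 * u ^+ 3 + e * u ^+ 4
    - (t0 + t1 * u + t2 * u ^+ 2)| <= `|x0 - t0| +
   C * (`|y| ^+ 4 * `|u| + `|y| ^+ 3 * `|u| ^+ 2 + `|y| ^+ 2 * `|u| ^+ 3 + `|u| ^+ 4).
Proof.
move=> C0 he h3 h2 h1.
have -> : x0 + x1 * u + x2 * u ^+ 2 + x3 * u ^+ 3 + e * u ^+ 4
    - (t0 + t1 * u + t2 * u ^+ 2) = (x0 - t0) + ((x1 - t1) * u + (x2 - t2) * u ^+ 2
     + x3 * u ^+ 3 + e * u ^+ 4) by ring.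
apply: le_trans (ler_normD _ _) _; rewrite lerD2l !mulrDr.
have fin (a b c : int) (n : nat) : `|a| <= c -> `|a * b ^+ n| <= c * `|b| ^+ n.
  by move=> h; rewrite normrM normrX ler_wpM2r ?exprn_ge0.
have fin' (a b c : int) (n : nat) : `|a| <= C * c -> `|a * b ^+ n| <= C * (c * `|b| ^+ n).
  by rewrite mulrA; apply: fin.
apply: le_trans (ler_normD _ _) _; apply: lerD; last exact: fin.
apply: le_trans (ler_normD _ _) _; apply: lerD; last exact: fin'.
apply: le_trans (ler_normD _ _) _; apply: lerD; last exact: fin'.
exact: (fin' _ _ _ 1).
Qed.

(** T is the main term of G, R the error and E the quantity to be dominated; the factor 5 counts the
    error monomials. As M > 10 A C, the product A C R is at most E / 2, so A G >= A T - A C R >= E /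
    2. *)
Fact dominated_by_main_term (G T E R A C M : int) :
  0 <= C -> E <= A * T -> `|G - T| <= C * R -> M * R <= 5 * E ->
  1 <= A -> M = 10 * A * C + 1 -> 0 <= E -> E <= 2 * A * G.
Proof.
move=> C0 ET; rewrite ler_norml => /andP[h _] MR A1 eM E0.
have AC0 : 0 <= A * C by rewrite mulr_ge0 // (le_trans _ A1).
have M0 : 0 < M by lia.
have h1 : M * E <= M * (A * T) by rewrite ler_pM2l.
have h2 : M * (A * T) <= M * (A * (G + C * R)).
  by rewrite !ler_pM2l ?(lt_le_trans _ A1) //; lia.
have h3 : A * C * (M * R) <= A * C * (5 * E) by rewrite ler_wpM2l.
rewrite -(ler_pM2l M0); have h4 : 0 <= (A * C) * E by rewrite mulr_ge0.
have : (10 * A * C + 1) * E <= 2 * (M * E) - 10 * (A * C * E) by rewrite eM; nia.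
rewrite -eM; lia.
Qed.

(** With f0 and f1 of degree at most 4, the main term a y^4 u^2 dominates all others as soon as |u|
    >= M. What remains lies on the finitely many lines with |u| <= M. *)
Lemma strip_definite_in_u f0 f1 f2 f3 e c0 c1 a c3 :
  polyf 5 c0 f0 -> polyf 4 c1 f1 -> polyf 4 a f2 -> polyf 2 c3 f3 ->
  0 < a -> bounded_below (quartic f0 f1 f2 f3 e) ->
  exists2 M : int, 0 <= M & sparse (strip M (quartic f0 f1 f2 f3 e)).
Proof.
move=> h0 h1 h2 h3 a0 bG; have [D hD] := bG.
(* On the line u = 0 the function is f0, whose coefficient of odd degree 5 must vanish. *)
have c00 : c0 = 0.
  apply: (@polyf_odd_lead 5 c0 f0 D) => // y.
  by have := hD 0 y; rewrite /quartic !expr0n /= !mulr0 !addr0.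
rewrite c00 in h0; have {h0}[c0' h0] := polyf_narrow h0.
have [C0 C00 b0] := polyf_bound h0; have [C1 C10 b1] := polyf_bound h1.
have [C2 C20 b2] := polyf_approx h2; have [C3 C30 b3] := polyf_bound h3.
pose C : int := C0 + C1 + C2 + C3 + `|e|.
have [le0 le1 le2 le3] : [/\ C0 <= C, C1 <= C, C2 <= C & C3 <= C].
  by clear -C00 C10 C20 C30; rewrite /C; split; lia.
have C_ge0 : 0 <= C by rewrite !addr_ge0.
pose M : int := 10 * 1 * C + 1; exists M; first by rewrite /M; lia.
have a1 : 1 <= a by lia.
pose G := quartic f0 f1 f2 f3 e.
pose P (u y : int) := [/\ M <= `|u|, M * `|u| <= y ^+ 2 & M <= `|y|].
have key u y : P u y -> u ^+ 2 + y ^+ 4 <= 4 * (G u y + 4).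
  move=> [Mu Muy My]; have y0 : y != 0 by apply/eqP => yE; move: My; rewrite yE /M; lia.
  have Muy' : M * `|u| <= `|y| ^+ 2 by rewrite real_normK ?num_real.
  have M1 : 1 <= M by rewrite /M; lia.
  have le_C (c b : int) (n : nat) : c <= C -> b <= c * `|y| ^+ n -> b <= C * `|y| ^+ n.
    by move=> cC hb; apply: le_trans hb _; rewrite ler_wpM2r ?exprn_ge0.
  have w4 : 0 <= `|y| ^+ 4 by rewrite exprn_ge0.
  have v1 : 1 <= `|u| by apply: le_trans Mu.
  have w1 : 1 <= `|y| by apply: le_trans My.
  have [p1 p2 p3] := powers_dominated M1 (normr_ge0 u) My Muy'.
  have p4 : M * (`|y| ^+ 4 * `|u|) <= `|y| ^+ 4 * `|u| ^+ 2.
    have -> : `|y| ^+ 4 * `|u| ^+ 2 = `|u| * (`|y| ^+ 4 * `|u|) by ring.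
    by rewrite ler_wpM2r // mulr_ge0.
  have p5 : M * `|y| ^+ 4 <= `|y| ^+ 4 * `|u| ^+ 2.
    by apply: le_trans p4; rewrite ler_wpM2l ?ler_peMr // (le_trans ler01).
  have E1 : `|y| ^+ 4 * `|u| ^+ 2 <= 2 * 1 * G u y.
    apply: (@dominated_by_main_term (G u y) (a * y ^+ 4 * u ^+ 2) _
       (`|y| ^+ 4 + (`|y| ^+ 4 * `|u| + `|y| ^+ 3 * `|u| ^+ 2 + `|y| ^+ 2 * `|u| ^+ 3 + `|u| ^+ 4))
       1 C M) => //.
    - have yu0 : 0 <= y ^+ 4 * u ^+ 2 by rewrite mulr_ge0 ?exprn_even_ge0.
      by rewrite mul1r -!normrX -normrM (ger0_norm yu0) -[a * _ * _]mulrA ler_peMl.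
    - have := @quartic_error (f0 y) (f1 y) (f2 y) (f3 y) 0 0 (a * y ^+ 4) e u y C C_ge0.
      rewrite !subr0 mul0r !add0r => q; rewrite mulrDr; apply: le_trans (q _ _ _ _) _.
      + by rewrite /C lerDr !addr_ge0.
      + exact: (le_C C3 _ _ _ (b3 y y0)).
      + exact: (le_C C2 _ _ _ (b2 y y0)).
      + exact: (le_C C1 _ _ _ (b1 y y0)).
      by rewrite lerD2r; exact: (le_C C0 _ _ _ (b0 y y0)).
    by rewrite !mulrDr; lia.
  have e1 : `|u| ^+ 2 <= `|y| ^+ 4 * `|u| ^+ 2 by rewrite ler_peMl ?exprn_ge0 ?exprn_ege1.
  have e2 : `|y| ^+ 4 <= `|y| ^+ 4 * `|u| ^+ 2 by rewrite ler_peMr ?exprn_ege1.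
  have -> : u ^+ 2 = `|u| ^+ 2 by rewrite real_normK ?num_real.
  have -> : y ^+ 4 = `|y| ^+ 4 by rewrite -normrX ger0_norm ?exprn_even_ge0.
  by lia.
apply: (sparse_sub _ (sparse_or (sparse_box (ler0n _ 4) key)
   (sparse_bigor_int M (fun u => sparse_line u h0 h1 h2 h3 bG)))).
move=> v [u [y [s1 s2 ->]]]; have [le_uM|lt_Mu] := lerP `|u| M.
  by right; exists u => //; exists y.
by left; exists u, y; split=> //; split=> //; apply: ltW.
Qed.

(** Completing the square in 4 a times the form and in 4 c times the form, and adding, leaves (4 a c
    - b^2) (u^2 + y^2). *)
Fact binary_quadratic_definite (a b c u y : int) : 0 < a -> b ^+ 2 < 4 * a * c ->
  u ^+ 2 + y ^+ 2 <= 4 * (a + c) * (a * u ^+ 2 + b * u * y + c * y ^+ 2).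
Proof.
move=> a0 disc.
have -> : 4 * (a + c) * (a * u ^+ 2 + b * u * y + c * y ^+ 2) =
  (2 * a * u + b * y) ^+ 2 + (2 * c * y + b * u) ^+ 2
  + (4 * a * c - b ^+ 2) * (u ^+ 2 + y ^+ 2) by ring.
have s0 : 0 <= u ^+ 2 + y ^+ 2 by rewrite addr_ge0 ?sqr_ge0.
have d1 : 1 <= 4 * a * c - b ^+ 2 by lia.
by apply: le_trans (ler_peMl s0 d1) _; rewrite lerDr addr_ge0 ?sqr_ge0.
Qed.

Fact sum5_le (M E s1 s2 s3 s4 s5 : int) : M * s1 <= E -> M * s2 <= E ->
  M * s3 <= E -> M * s4 <= E -> M * s5 <= E -> M * (s1 + (s2 + s3 + s4 + s5)) <= 5 * E.
Proof. by move=> *; rewrite !mulrDr; lia. Qed.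

(** The main term y^4 (a u^2 + b u y + c y^2) is y^4 times a positive definite form, so it dominates
    y^4 (u^2 + y^2) on the whole strip. *)
Lemma strip_definite f0 f1 f2 f3 e c b a c3 :
  polyf 6 c f0 -> polyf 5 b f1 -> polyf 4 a f2 -> polyf 2 c3 f3 ->
  0 < a -> b ^+ 2 < 4 * a * c ->
  exists2 M : int, 0 <= M & sparse (strip M (quartic f0 f1 f2 f3 e)).
Proof.
move=> h0 h1 h2 h3 a0 disc; have a1 : 1 <= a by lia.
have c0 : 0 < c.
  have : 0 < 4 * a * c by apply: le_lt_trans disc; rewrite sqr_ge0.
  by rewrite pmulr_rgt0 // mulr_gt0.
have [C0 C00 b0] := polyf_approx h0; have [C1 C10 b1] := polyf_approx h1.
have [C2 C20 b2] := polyf_approx h2; have [C3 C30 b3] := polyf_bound h3.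
pose C : int := C0 + C1 + C2 + C3 + `|e|.
have [le0 le1 le2 le3] : [/\ C0 <= C, C1 <= C, C2 <= C & C3 <= C].
  by clear -C00 C10 C20 C30; rewrite /C; split; lia.
have C_ge0 : 0 <= C by rewrite !addr_ge0.
(* The constant of [binary_quadratic_definite]. *)
have [A AE A1] : exists2 A, A = 4 * (a + c) & 1 <= A by exists (4 * (a + c)); lia.
have A0 : 0 <= A by apply: le_trans A1.
pose M : int := 10 * A * C + 1.
have M1 : 1 <= M by rewrite /M lerDr !mulr_ge0.
exists M; first by rewrite (le_trans ler01).
pose G := quartic f0 f1 f2 f3 e.
pose P (u y : int) := M * `|u| <= y ^+ 2 /\ M <= `|y|.
have A20 : 0 <= 2 * A by rewrite mulr_ge0.
have key u y : P u y -> u ^+ 2 + y ^+ 4 <= 2 * A * (G u y + 2 * A).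
  move=> [Muy My].
  have w1 : 1 <= `|y| by apply: le_trans My.
  have y0 : y != 0 by rewrite -normr_gt0 (lt_le_trans ltr01).
  have Muy' : M * `|u| <= `|y| ^+ 2 by rewrite real_normK ?num_real.
  have le_C (C' t : int) (n : nat) : C' <= C -> t <= C' * `|y| ^+ n -> t <= C * `|y| ^+ n.
    by move=> cC hb; apply: le_trans hb _; rewrite ler_wpM2r ?exprn_ge0.
  have [p1 p2 p3] := powers_dominated M1 (normr_ge0 u) My Muy'.
  have w4 : 0 <= `|y| ^+ 4 by rewrite exprn_ge0.
  have p4 : M * (`|y| ^+ 4 * `|u|) <= `|y| ^+ 4 * (`|u| ^+ 2 + `|y| ^+ 2).
    have -> : M * (`|y| ^+ 4 * `|u|) = `|y| ^+ 4 * (M * `|u|) by ring.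
    by rewrite ler_wpM2l // (le_trans Muy') // lerDr exprn_ge0.
  have p5 : M * `|y| ^+ 5 <= `|y| ^+ 4 * `|y| ^+ 2.
    by rewrite -exprD (exprS _ 5) ler_wpM2r ?exprn_ge0.
  have le_E : `|y| ^+ 4 * `|u| ^+ 2 <= `|y| ^+ 4 * (`|u| ^+ 2 + `|y| ^+ 2).
    by rewrite ler_wpM2l // lerDl exprn_ge0.
  have {}p5 : M * `|y| ^+ 5 <= `|y| ^+ 4 * (`|u| ^+ 2 + `|y| ^+ 2).
    by apply: le_trans p5 _; rewrite ler_wpM2l // lerDr exprn_ge0.
  have E1 : `|y| ^+ 4 * (`|u| ^+ 2 + `|y| ^+ 2) <= 2 * A * G u y.
    apply: (@dominated_by_main_term (G u y) (c * y ^+ 6 + b * y ^+ 5 * u + a * y ^+ 4 * u ^+ 2) _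
       (`|y| ^+ 5 + (`|y| ^+ 4 * `|u| + `|y| ^+ 3 * `|u| ^+ 2 + `|y| ^+ 2 * `|u| ^+ 3 + `|u| ^+ 4))
       A C M) => //.
    - have -> : A * (c * y ^+ 6 + b * y ^+ 5 * u + a * y ^+ 4 * u ^+ 2) =
        y ^+ 4 * (A * (a * u ^+ 2 + b * u * y + c * y ^+ 2)) by ring.
      rewrite -(normrX 4) ger0_norm ?exprn_even_ge0 // !real_normK ?num_real //.
      by rewrite ler_wpM2l ?exprn_even_ge0 // AE binary_quadratic_definite.
    - rewrite mulrDr; apply: le_trans (@quartic_error (f0 y) (f1 y) (f2 y) (f3 y)
        (c * y ^+ 6) (b * y ^+ 5) (a * y ^+ 4) e u y C C_ge0 _ _ _ _) _.
      + by rewrite /C lerDr !addr_ge0.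
      + exact: (le_C C3 _ _ _ (b3 y y0)).
      + exact: (le_C C2 _ _ _ (b2 y y0)).
      + exact: (le_C C1 _ _ _ (b1 y y0)).
      by rewrite lerD2r; exact: (le_C C0 _ _ _ (b0 y y0)).
    by apply: sum5_le => //; apply: le_trans le_E => //.
  have e1 : `|u| ^+ 2 <= `|y| ^+ 4 * `|u| ^+ 2 by rewrite ler_peMl ?exprn_ge0 ?exprn_ege1.
  have e2 : `|y| ^+ 4 <= `|y| ^+ 4 * `|y| ^+ 2 by rewrite ler_peMr ?exprn_ege1.
  have -> : u ^+ 2 = `|u| ^+ 2 by rewrite real_normK ?num_real.
  have -> : y ^+ 4 = `|y| ^+ 4 by rewrite -normrX ger0_norm ?exprn_even_ge0.
  apply: le_trans (lerD e1 e2) _; rewrite -mulrDr (le_trans E1) //.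
  by rewrite ler_wpM2l // lerDl.
apply: (sparse_sub _ (sparse_box A20 key)).
by move=> v [u [y [s1 s2 ->]]]; exists u, y.
Qed.

(** Transfers a strip in (z, y) to one in (X, k), where y = A k + j. The second summand of M forces
    |k| >= 2 N B + N + 1, so that N B |k| <= k^2 / 2; the first then gives N |z| <= k^2 / 2, because
    |y| <= 2 A |k|. *)
Fact residue_strip (A N B z X k j : int) : 0 < A -> 0 <= N -> 0 <= B ->
  0 <= j < A -> `|X| <= `|z| + B * `|k| ->
  let M := 8 * A ^+ 2 * N + A * (2 * N * B + N + 2) in
  M * `|z| <= (A * k + j) ^+ 2 -> M <= `|A * k + j| ->
  N * `|X| <= k ^+ 2 /\ N <= `|k|.
Proof.
move=> A0 N0 B0 /andP[j0 jA] hX M h1 h2.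
have hy : `|A * k + j| <= A * (`|k| + 1).
  apply: le_trans (ler_normD _ _) _; rewrite normrM (ger0_norm (ltW A0)) (ger0_norm j0).
  by rewrite mulrDr mulr1 lerD2l ltW.
have NB0 : 0 <= N * B by rewrite mulr_ge0.
have k_ge : 2 * N * B + N + 1 <= `|k|.
  suff : 2 * N * B + N + 2 <= `|k| + 1 by lia.
  rewrite -(ler_pM2l A0); apply: le_trans hy; apply: le_trans h2.
  by rewrite lerDr !mulr_ge0 ?exprn_ge0 // ltW.
have k1 : 1 <= `|k| by lia.
have hy2 : (A * k + j) ^+ 2 <= 4 * A ^+ 2 * k ^+ 2.
  have -> : 4 * A ^+ 2 * k ^+ 2 = (A * (2 * `|k|)) ^+ 2.
    by rewrite -(real_normK (num_real k)); ring.
  rewrite -(real_normK (num_real (A * k + j))) ler_pXn2r ?nnegrE //; last first.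
    by rewrite !mulr_ge0 // ltW.
  by apply: le_trans hy _; rewrite ler_pM2l //; lia.
have hz : 2 * N * `|z| <= k ^+ 2.
  have A2 : 0 < 4 * A ^+ 2 by rewrite mulr_gt0 ?exprn_gt0.
  rewrite -(ler_pM2l A2); apply: le_trans hy2; apply: le_trans h1.
  have -> : 4 * A ^+ 2 * (2 * N * `|z|) = 8 * A ^+ 2 * N * `|z| by ring.
  rewrite ler_wpM2r // lerDl mulr_ge0 ?ltW //.
  by clear -NB0 N0; lia.
have hk : 2 * (N * B) * `|k| <= k ^+ 2.
  rewrite -(real_normK (num_real k)) expr2 ler_wpM2r //.
  by clear -k_ge N0; lia.
split; last by clear -k_ge NB0; lia.
have : N * `|X| <= N * (`|z| + B * `|k|) by rewrite ler_wpM2l.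
by clear -hz hk; lia.
Qed.

(** The shifts that simplify G have rational coefficients and become integral on each class of y
    modulo A. There are finitely many classes, so one M serves them all. The alternative k = 0
    accommodates shifts whose error has a constant term. *)
Lemma sparse_by_residues (A : nat) (B : int) (z G : int -> int -> int) :
  (0 < A)%N -> 0 <= B ->
  (forall j : nat, (j < A)%N -> exists g : int -> int -> int,
     (exists2 M : int, 0 <= M & sparse (strip M g)) /\
     forall u k, exists2 X, G u (A%:Z * k + j%:Z) = g X k &
       `|X| <= `|z u (A%:Z * k + j%:Z)| + B * `|k| \/ k = 0) ->
  exists2 M : int, 0 <= M &
    sparse (fun v => exists u y, [/\ M * `|z u y| <= y ^+ 2, M <= `|y| & v = G u y]).
Proof.
move=> A0 B0 hG.
pose S (j : nat) (M : int) v := exists u k, let y := A%:Z * k + j%:Z in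
   [/\ M * `|z u y| <= y ^+ 2, M <= `|y| & v = G u y].
have SS j M N : 0 <= M <= N -> forall v, S j N v -> S j M v.
  move=> /andP[M0 MN] v [u [k /= [h1 h2 ->]]]; exists u, k; split=> //.
    by apply: le_trans h1; rewrite ler_wpM2r.
  exact: le_trans h2.
have one j : (j < A)%N -> exists2 M : int, 0 <= M & sparse (S j M).
  move=> jA; have [g [[N N0 spN] hg]] := hG j jA.
  exists (8 * A%:Z ^+ 2 * N + A%:Z * (2 * N * B + N + 2)).
    by rewrite addr_ge0 ?mulr_ge0 ?exprn_ge0 // !addr_ge0 ?mulr_ge0.
  apply: (sparse_sub _ spN) => v [u [k /= [h1 h2 ->]]].
  have [X -> hX] := hg u k; exists X, k.
  case: hX => [hX|k0]; first by have [] := residue_strip _ N0 B0 _ hX h1 h2; rewrite ?lez_nat //; lia.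
  (* At k = 0 one has |y| = j < A, whereas the bound on |y| from below is at least 2 A. *)
  exfalso; move: h2; rewrite k0 mulr0 add0r; apply/negP; rewrite -ltNge.
  have -> : 8 * A%:Z ^+ 2 * N + A%:Z * (2 * N * B + N + 2) =
    2 * A%:Z + (8 * A%:Z ^+ 2 * N + A%:Z * (2 * N * B + N)) by ring.
  have : 0 <= 8 * A%:Z ^+ 2 * N + A%:Z * (2 * N * B + N).
    by rewrite addr_ge0 ?mulr_ge0 ?exprn_ge0 // addr_ge0 ?mulr_ge0.
  by move: (8 * _ * N + _) => t; clear -jA; lia.
have all n : (n <= A)%N ->
    exists2 M : int, 0 <= M & forall j, (j < n)%N -> sparse (S j M).
  elim: n => [_|n IHn nA]; first by exists 0.
  have [M M0 hM] := IHn (ltnW nA); have [N N0 hN] := one n nA.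
  exists (M + N) => [|j]; first by rewrite addr_ge0.
  rewrite ltnS leq_eqVlt => /orP[/eqP -> |jn].
    by apply: sparse_sub hN; apply: SS; rewrite N0 lerDr.
  by apply: sparse_sub (hM j jn); apply: SS; rewrite M0 lerDl.
have [M M0 hM] := all A (leqnn A); exists M => //.
apply: (sparse_sub _ (sparse_bigor hM)) => v [u [y [h1 h2 ->]]].
exists (absz (y %% A%:Z)%Z).
  by rewrite -ltz_nat gez0_abs ?modz_ge0 ?ltz_pmod //; lia.
have ey : A%:Z * (y %/ A%:Z)%Z + (y %% A%:Z)%Z = y by rewrite mulrC -divz_eq.
exists u, (y %/ A%:Z)%Z => /=; rewrite gez0_abs ?modz_ge0 //; last lia.
by rewrite ey.
Qed.

Lemma bounded_below_odd f0 f1 f2 f3 e n c :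
  odd n -> polyf n c f0 -> bounded_below (quartic f0 f1 f2 f3 e) -> c = 0.
Proof.
move=> on h0 [D hD]; apply: (polyf_odd_lead (D := D) on h0) => y.
by have := hD 0 y; rewrite /quartic !expr0n /= !mulr0 !addr0.
Qed.

Lemma bounded_below_lead f0 f1 f2 f3 e n c :
  polyf n.+1 c f0 -> bounded_below (quartic f0 f1 f2 f3 e) -> 0 <= c.
Proof.
move=> h0 [D hD]; apply: (polyf_lead_ge0 (D := D) h0) => y.
by have := hD 0 y; rewrite /quartic !expr0n /= !mulr0 !addr0.
Qed.

(** Boundedness from below makes the form a u^2 + b u y + c y^2 nonnegative. It is either definite
    or, up to the factor 4 a, the square of 2 a u + b y; in the second case this linear form becomes
    the new variable. *)
Lemma strip_general f0 f1 f2 f3 e c b a c3 :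
  polyf 6 c f0 -> polyf 5 b f1 -> polyf 4 a f2 -> polyf 2 c3 f3 ->
  0 < a -> bounded_below (quartic f0 f1 f2 f3 e) ->
  exists2 M : int, 0 <= M & sparse (strip M (quartic f0 f1 f2 f3 e)).
Proof.
move=> h0 h1 h2 h3 a0 bG; case: a a0 h2 => // a a0 h2.
(* Shift u = X - b k on the class y = 2 a k + j; the degree bounds are 6, 5, 4, 3, 2. *)
have tr (j : int) := quartic_transform (d := 2) (m := 1) (2 * a)%N%:Z j h0 h1 h2 (polyf_wide h3)
  (polyf_wide (polyf_wide (polyf_cst e))) (polyf_scale (- b) polyf_id).
have bg g0 g1 g2 g3 j : (forall X k, quartic g0 g1 g2 g3 e X k =
    quartic f0 f1 f2 f3 e (X + - b * k) ((2 * a)%N%:Z * k + j)) ->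
    bounded_below (quartic g0 g1 g2 g3 e).
  by move=> gE; have [D hD] := bG; exists D => u y; rewrite gE.
(* On the line u = - b k, y = 2 a k the coefficient of k^6 is 16 a^5 (4 a c - b^2). *)
have disc : b ^+ 2 <= 4 * a%:Z * c.
  have [g0 [g1 [g2 [g3 [k0 k1 k2 k3 gE]]]]] := tr 0.
  have := bounded_below_lead k0 (bg _ _ _ _ _ gE).
  rewrite /= PoszM; set lhs := (X in 0 <= X).
  have -> : lhs = 16 * a%:Z ^+ 5 * (4 * a%:Z * c - b ^+ 2) by rewrite /lhs; ring.
  by rewrite pmulr_rge0 ?subr_ge0 // mulr_gt0 ?exprn_gt0.
have [ltd|ged] := ltrP (b ^+ 2) (4 * a%:Z * c); first exact: (strip_definite e h0 h1 h2 h3).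
have {ged disc} disc : b ^+ 2 = 4 * a%:Z * c by apply/eqP; rewrite eq_le disc.
apply: (@sparse_by_residues (2 * a)%N `|b| (fun u _ => u)) => // [|j ja].
  by rewrite muln_gt0.
have [g0 [g1 [g2 [g3 [k0 k1 k2 k3 gE]]]]] := tr j%:Z.
exists (quartic g0 g1 g2 g3 e); split; last first.
  move=> u k; exists (u + b * k); first by rewrite gE; congr (quartic _ _ _ _ _ _ _); ring.
  by left; rewrite (le_trans (ler_normD _ _)) // normrM.
(* In the variables X and k the coefficients of k^6 and X k^5 cancel, and the main term is a (2 a)^4
   k^4 X^2. *)
have [c0' k0'] : exists c, polyf 5 c g0.
  apply: polyf_narrow; apply: polyf_eq k0 _ _ => //.
  have -> : c * (2 * a)%N%:Z ^+ 6 = (16 * a%:Z ^+ 5) * (4 * a%:Z * c) by rewrite PoszM; ring.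
  by rewrite -disc PoszM /=; ring.
have [c1' k1'] : exists c, polyf 4 c g1.
  by apply: polyf_narrow; apply: polyf_eq k1 _ _ => //; rewrite PoszM /=; ring.
have [c3' k3'] : exists c, polyf 2 c g3.
  by apply: polyf_narrow; apply: polyf_eq k3 _ _ => //; ring.
apply: (strip_definite_in_u k0' k1' k2 k3' _ (bg _ _ _ _ _ gE)).
by rewrite !mul0r !mulr0 !addr0 mulr_gt0 ?exprn_gt0 // ltz_nat muln_gt0.
Qed.

(** * The neighbourhood of the parabola *)

(** The weighted leading part is u^2 (2 e u + c3 y^2)^2 / (4 e), in which the parabola plays the
    same role as u = 0. A shift along it leads back to [strip_general]. *)
Lemma parabolic_strip f0 f1 f2 f3 e c b a c3 :
  polyf 6 c f0 -> polyf 5 b f1 -> polyf 4 a f2 -> polyf 2 c3 f3 ->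
  0 < a -> 0 < e -> c3 ^+ 2 = 4 * a * e -> bounded_below (quartic f0 f1 f2 f3 e) ->
  exists2 M : int, 0 <= M & sparse (fun v => exists u y,
    [/\ M * `|2 * e * u + c3 * y ^+ 2| <= y ^+ 2, M <= `|y|
      & v = quartic f0 f1 f2 f3 e u y]).
Proof.
move=> h0 h1 h2 h3 a0 e0 disc bG; case: e e0 disc bG => // e e0 disc bG.
pose h (k : int) : int := - (2 * c3 * e%:Z) * (k * k).
have hh : polyf 2 (- (2 * c3 * e%:Z)) h.
  by apply: polyf_eq (polyf_scale _ (polyfM polyf_id polyf_id)) _ _ => //; ring.
(* With y = 2 e k + j, the number 2 e X differs from 2 e u + c3 y^2 by 4 c3 e j k + c3 j^2. As j < 2
   e, the constant times |k| bounds this when k is not 0. *)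
apply: (@sparse_by_residues (2 * e)%N (4 * `|c3| * e%:Z * (2 * e)%N%:Z + `|c3| * (2 * e)%N%:Z ^+ 2)
  (fun u y => 2 * e%:Z * u + c3 * y ^+ 2)); first by rewrite muln_gt0.
  by rewrite addr_ge0 ?mulr_ge0 ?exprn_ge0.
move=> j je.
(* The shift is quadratic in k, so the degree bounds are 8, 6, 4, 2, 0. *)
have [g0 [g1 [g2 [g3 [k0 k1 k2 k3 gE]]]]] := quartic_transform (d := 0) (m := 2) (2 * e)%N%:Z j%:Z
   (polyf_wide (polyf_wide h0)) (polyf_wide h1) h2 h3 (polyf_cst e%:Z) hh.
have bg : bounded_below (quartic g0 g1 g2 g3 e%:Z).
  by have [D hD] := bG; exists D => u y; rewrite gE.
(* The coefficient of k^8 is a multiple of 4 a e - c3^2 = 0, and the one of k^7 vanishes because the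
   degree is odd. *)
have [c0' k0'] : exists c, polyf 6 c g0.
  have [c7 k7] : exists c, polyf 7 c g0.
    apply: polyf_narrow; apply: polyf_eq k0 _ _ => //.
    have e4 : 4 * a * e%:Z - c3 ^+ 2 = 0 by rewrite disc subrr.
    rewrite PoszM /=; set lhs := LHS.
    have -> : lhs = (4 * a * e%:Z - c3 ^+ 2) * (16 * c3 ^+ 2 * e%:Z ^+ 5) by rewrite /lhs; ring.
    by rewrite e4 mul0r.
  have c70 : c7 = 0 by apply: bounded_below_odd k7 bg.
  by rewrite c70 in k7; apply: polyf_narrow.
have [c1' k1'] : exists c, polyf 5 c g1.
  apply: polyf_narrow; apply: polyf_eq k1 _ _ => //.
  have e4 : c3 ^+ 2 - 4 * a * e%:Z = 0 by rewrite disc subrr.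
  rewrite PoszM /=; set lhs := LHS.
  have -> : lhs = (c3 ^+ 2 - 4 * a * e%:Z) * (16 * c3 * e%:Z ^+ 4) by rewrite /lhs; ring.
  by rewrite e4 mul0r.
have k2' : polyf 4 (16 * a * e%:Z ^+ 4) g2.
  by apply: polyf_eq k2 _ _ => //; rewrite PoszM /=; ring.
exists (quartic g0 g1 g2 g3 e%:Z); split.
  by apply: (strip_general k0' k1' k2' k3 _ bg); rewrite !mulr_gt0 ?exprn_gt0.
move=> u k; exists (u + 2 * c3 * e%:Z * (k * k)).
  by rewrite gE; congr (quartic _ _ _ _ _ _ _); rewrite /h; ring.
have [->|k0''] := eqVneq k 0; [by right | left].
set y := _ + j%:Z; set X := u + _.
have eX : 2 * e%:Z * X = (2 * e%:Z * u + c3 * y ^+ 2)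
    - (4 * c3 * e%:Z * j%:Z * k + c3 * j%:Z ^+ 2).
  by rewrite /X /y PoszM; ring.
have kge1 : 1 <= `|k| by rewrite -gtz0_ge1 normr_gt0.
have le_j : j%:Z <= (2 * e)%N%:Z by rewrite lez_nat ltnW.
apply: le_trans (_ : `|2 * e%:Z * X| <= _).
  by rewrite normrM ler_peMl // normrM !ger0_norm //; clear -e0; lia.
rewrite eX; apply: le_trans (ler_normB _ _) _; rewrite lerD2l.
apply: le_trans (ler_normD _ _) _; rewrite [leRHS]mulrDl; apply: lerD.
  rewrite !normrM ler_wpM2r // (ger0_norm (_ : 0 <= 4)) // (ger0_norm (le0z_nat _)).
  by rewrite (ger0_norm (le0z_nat _)) ler_wpM2l // !mulr_ge0.
rewrite normrM normrX (ger0_norm (le0z_nat _)).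
apply: le_trans (_ : `|c3| * (2 * e)%N%:Z ^+ 2 <= _).
  by rewrite ler_wpM2l // ler_pXn2r ?nnegrE.
by rewrite ler_peMr // mulr_ge0 ?exprn_ge0.
Qed.

(** * The region away from the zeros of the main part *)

(** With d = 0 the coefficient of u^3 carries no error. The final 0 pads the sum to the shape of
    [sum5_le]. *)
Fact outside_error (x0 x1 x2 x3 t2 t3 d e u y C : int) :
  0 <= C -> `|x3 - t3| <= C * (d * `|y|) -> `|x2 - t2| <= C * `|y| ^+ 3 ->
  `|x1| <= C * `|y| ^+ 5 -> `|x0| <= C * `|y| ^+ 6 ->
  `|x0 + x1 * u + x2 * u ^+ 2 + x3 * u ^+ 3 + e * u ^+ 4
    - (t2 * u ^+ 2 + t3 * u ^+ 3 + e * u ^+ 4)| <=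
   C * (`|y| ^+ 6 + (`|y| ^+ 5 * `|u| + `|y| ^+ 3 * `|u| ^+ 2 + d * `|y| * `|u| ^+ 3 + 0)).
Proof.
move=> C0 h3 h2 h1 h0; rewrite addr0.
have -> : x0 + x1 * u + x2 * u ^+ 2 + x3 * u ^+ 3 + e * u ^+ 4
    - (t2 * u ^+ 2 + t3 * u ^+ 3 + e * u ^+ 4) =
    x0 + (x1 * u + (x2 - t2) * u ^+ 2 + (x3 - t3) * u ^+ 3) by ring.
have fin (a b c : int) (n : nat) : `|a| <= C * c -> `|a * b ^+ n| <= C * (c * `|b| ^+ n).
  by move=> h; rewrite normrM normrX mulrA ler_wpM2r ?exprn_ge0.
rewrite !(mulrDr C); apply: le_trans (ler_normD _ _) _; apply: lerD => //.
apply: le_trans (ler_normD _ _) _; apply: lerD; last exact: fin.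
apply: le_trans (ler_normD _ _) _; apply: lerD; last exact: fin.
exact: (fin _ _ _ 1).
Qed.

(** Here v = |u| and w = |y|. Outside the strip a factor w^2 can be traded for K v; the last
    monomial uses M <= w and w^2 v <= w^4 + v^2. *)
Fact outside_powers (M K v w d : int) : 1 <= M -> M <= w -> 0 <= v -> 1 <= K ->
  w ^+ 2 <= K * v -> 0 <= d ->
  let E := K ^+ 2 * (v ^+ 2 * (w ^+ 4 + d * v ^+ 2)) in
  d <= 1 ->
  [/\ M * w ^+ 6 <= E, M * (w ^+ 5 * v) <= E, M * (w ^+ 3 * v ^+ 2) <= E
    & M * (d * w * v ^+ 3) <= E].
Proof.
move=> M1 Mw v0 K1 wKv d0 E d1.
have w1 : 1 <= w by apply: le_trans Mw.
have w0 : 0 <= w by apply: le_trans w1.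
have K0 : 0 <= K by apply: le_trans K1.
have wE : K ^+ 2 * (w ^+ 4 * v ^+ 2) <= E.
  rewrite /E ler_wpM2l ?exprn_ge0 // (mulrC _ (v ^+ 2)) ler_wpM2l ?exprn_ge0 //.
  by rewrite lerDl mulr_ge0 ?exprn_ge0.
have MKv : M <= K * v.
  by apply: le_trans wKv; apply: le_trans Mw _; rewrite expr2 ler_peMr.
have KK : K <= K ^+ 2 by rewrite expr2 ler_peMr.
have w4v : 0 <= w ^+ 4 * v ^+ 2 by rewrite mulr_ge0 ?exprn_ge0.
split.
- apply: le_trans wE; have -> : K ^+ 2 * (w ^+ 4 * v ^+ 2) = (K * v) * (w ^+ 4 * (K * v)) by ring.
  apply: ler_pM; [exact: le_trans M1 | exact: exprn_ge0 | exact: MKv |].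
  by have -> : w ^+ 6 = w ^+ 4 * w ^+ 2; [ring | rewrite ler_wpM2l ?exprn_ge0].
- apply: le_trans wE; apply: le_trans (_ : K * (w ^+ 4 * v ^+ 2) <= _); last first.
    by rewrite ler_wpM2r.
  have -> : K * (w ^+ 4 * v ^+ 2) = K * v * (w ^+ 4 * v) by ring.
  have -> : M * (w ^+ 5 * v) = M * w * (w ^+ 4 * v) by ring.
  rewrite ler_wpM2r ?mulr_ge0 ?exprn_ge0 // (le_trans _ wKv) // expr2.
  by rewrite ler_wpM2r.
- apply: le_trans wE; apply: le_trans (_ : w ^+ 4 * v ^+ 2 <= _); last first.
    by rewrite ler_peMl // exprn_ege1.
  by rewrite mulrA (exprS w 3) ler_wpM2r ?exprn_ge0 // ler_wpM2r ?exprn_ge0.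
apply: le_trans (_ : v ^+ 2 * (d * (w ^+ 2 * v)) <= _).
  have -> : v ^+ 2 * (d * (w ^+ 2 * v)) = w * (d * w * v ^+ 3) by ring.
  by rewrite ler_wpM2r // !mulr_ge0 ?exprn_ge0.
rewrite /E; apply: le_trans (_ : v ^+ 2 * (w ^+ 4 + d * v ^+ 2) <= _); last first.
  by rewrite ler_peMl ?exprn_ege1 // mulr_ge0 ?addr_ge0 ?mulr_ge0 ?exprn_ge0.
rewrite ler_wpM2l ?exprn_ge0 //; apply: le_trans (_ : d * w ^+ 4 + d * v ^+ 2 <= _).
  rewrite -mulrDr ler_wpM2l //.
  have : 0 <= (w ^+ 2 - v) ^+ 2 by rewrite sqr_ge0.
  have : 0 <= w ^+ 2 * v by rewrite mulr_ge0 ?exprn_ge0.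
  have -> : (w ^+ 2 - v) ^+ 2 = w ^+ 4 + v ^+ 2 - 2 * (w ^+ 2 * v) by ring.
  by move: (w ^+ 4) (v ^+ 2) (w ^+ 2 * v) => p q r; clear; lia.
by rewrite lerD2r ler_piMl // exprn_ge0.
Qed.

(* The case [d = 0] is that of a main term [a * y ^+ 4 * u ^+ 2] alone, which
   does not dominate [u ^+ 4]. *)
Lemma sparse_outside f0 f1 f2 f3 e c b a c3 (d A K : int) (Q : int -> int -> bool) :
  polyf 6 c f0 -> polyf 5 b f1 -> polyf 4 a f2 -> polyf 2 c3 f3 ->
  d = 1 \/ d = 0 /\ (forall y, f3 y = c3 * y ^+ 2) -> 1 <= A -> 1 <= K ->
  (forall u y, Q u y -> u ^+ 2 * (y ^+ 4 + d * u ^+ 2) <=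
     A * (a * y ^+ 4 * u ^+ 2 + c3 * y ^+ 2 * u ^+ 3 + e * u ^+ 4)) ->
  exists2 N : int, 0 <= N & sparse (fun v => exists u y,
    [/\ N <= `|y|, y ^+ 2 <= K * `|u|, Q u y & v = quartic f0 f1 f2 f3 e u y]).
Proof.
move=> h0 h1 h2 h3 hd A1 K1 hQ.
have [C0 C00 b0] := polyf_bound h0; have [C1 C10 b1] := polyf_bound h1.
have [C2 C20 b2] := polyf_approx h2; have [C3 C30 b3] := polyf_approx h3.
pose C : int := C0 + C1 + C2 + C3.
have [le0 le1 le2 le3] : [/\ C0 <= C, C1 <= C, C2 <= C & C3 <= C].
  by clear -C00 C10 C20 C30; rewrite /C; split; lia.
have C_ge0 : 0 <= C by rewrite !addr_ge0.
have [d0 d1] : 0 <= d /\ d <= 1 by case: hd => [->|[-> _]].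
have [B BE B1] : exists2 B, B = K ^+ 2 * A & 1 <= B.
  by exists (K ^+ 2 * A) => //; rewrite mulr_ege1 ?exprn_ege1.
have B0 : 0 <= B by apply: le_trans B1.
have K0 : 0 <= K by apply: le_trans K1.
pose M : int := 10 * B * C + 1.
have M1 : 1 <= M by rewrite /M lerDr !mulr_ge0.
exists M; first by rewrite (le_trans ler01).
pose G := quartic f0 f1 f2 f3 e.
pose P (u y : int) := [/\ M <= `|y|, y ^+ 2 <= K * `|u| & Q u y].
have B20 : 0 <= 2 * (2 * B) by rewrite !mulr_ge0.
have key u y : P u y -> u ^+ 2 + y ^+ 4 <= 2 * (2 * B) * (G u y + 2 * (2 * B)).
  move=> [My yKu Quy].
  have w1 : 1 <= `|y| by apply: le_trans My.
  have y0 : y != 0 by rewrite -normr_gt0 (lt_le_trans ltr01).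
  have yKu' : `|y| ^+ 2 <= K * `|u| by rewrite real_normK ?num_real.
  have v1 : 1 <= `|u|.
    rewrite -gtz0_ge1 normr_gt0; apply/eqP => u0; move: yKu'.
    by rewrite u0 normr0 mulr0 leNgt exprn_gt0 // (lt_le_trans ltr01).
  have le_C (C' t : int) (n : nat) : C' <= C -> t <= C' * `|y| ^+ n -> t <= C * `|y| ^+ n.
    by move=> cC hb; apply: le_trans hb _; rewrite ler_wpM2r ?exprn_ge0.
  have [p1 p2 p3 p4] := outside_powers M1 My (normr_ge0 u) K1 yKu' d0 d1.
  have u2E : u ^+ 2 = `|u| ^+ 2 by rewrite real_normK ?num_real.
  have y4E : y ^+ 4 = `|y| ^+ 4 by rewrite -normrX ger0_norm ?exprn_even_ge0.
  set E := K ^+ 2 * _ in p1 p2 p3 p4.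
  have E1 : E <= 2 * B * G u y.
    apply: (@dominated_by_main_term (G u y)
        (a * y ^+ 4 * u ^+ 2 + c3 * y ^+ 2 * u ^+ 3 + e * u ^+ 4) _
       (`|y| ^+ 6 + (`|y| ^+ 5 * `|u| + `|y| ^+ 3 * `|u| ^+ 2 + d * `|y| * `|u| ^+ 3 + 0))
       B C M) => //.
    - by rewrite BE -mulrA /E -u2E -y4E ler_wpM2l ?exprn_ge0 ?hQ.
    - apply: (@outside_error (f0 y) (f1 y) (f2 y) (f3 y) (a * y ^+ 4) (c3 * y ^+ 2)) => //.
      + case: hd => [->|[-> ->]]; last by rewrite subrr normr0 mul0r mulr0.
        by rewrite mul1r; exact: (le_C C3 _ 1 _ (b3 y y0)).
      + exact: (le_C C2 _ _ _ (b2 y y0)).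
      + exact: (le_C C1 _ _ _ (b1 y y0)).
      exact: (le_C C0 _ _ _ (b0 y y0)).
    - apply: sum5_le => //; rewrite mulr0.
      by rewrite /E !mulr_ge0 ?addr_ge0 ?mulr_ge0 ?exprn_ge0.
    by rewrite /E !mulr_ge0 ?addr_ge0 ?mulr_ge0 ?exprn_ge0.
  have e0 : `|u| ^+ 2 * `|y| ^+ 4 <= E.
    apply: le_trans (_ : `|u| ^+ 2 * (`|y| ^+ 4 + d * `|u| ^+ 2) <= _).
      by rewrite ler_wpM2l ?exprn_ge0 // lerDl mulr_ge0 ?exprn_ge0.
    by rewrite /E ler_peMl ?exprn_ege1 // mulr_ge0 ?addr_ge0 ?mulr_ge0 ?exprn_ge0.
  have e1 : `|u| ^+ 2 <= E by apply: le_trans e0; rewrite ler_peMr ?exprn_ge0 ?exprn_ege1.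
  have e2 : `|y| ^+ 4 <= E by apply: le_trans e0; rewrite ler_peMl ?exprn_ge0 ?exprn_ege1.
  rewrite u2E y4E; apply: le_trans (_ : 2 * (2 * B * G u y) <= _).
    by apply: le_trans (lerD e1 e2) _; move: E1; clear; move: (2 * B * _) => t; lia.
  by rewrite mulrA ler_wpM2l // lerDl.
apply: (sparse_sub _ (sparse_box B20 key)).
by move=> v [u [y [s1 s2 s3 ->]]]; exists u, y.
Qed.

(** * Covering the plane *)

Lemma sparse_row f0 f1 f2 f3 e y : bounded_below (quartic f0 f1 f2 f3 e) ->
  sparse (fun v => exists u, v = quartic f0 f1 f2 f3 e u y).
Proof.
move=> [D hD].
pose p := (f0 y)%:P + (f1 y)%:P * 'X + (f2 y)%:P * 'X^2 + (f3 y)%:P * 'X^3 + e%:P * 'X^4.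
have pE u : quartic f0 f1 f2 f3 e u y = p.[u] by rewrite /quartic !hornerE.
apply: (sparse_sub _ (@sparse_poly p D _)) => [v [u ->]|u]; first by exists u.
by rewrite -pE.
Qed.

(** The plane is cut into finitely many rows with small |y|, the points where Q holds, the strip
    around u = 0, and the rest, where the main part dominates. Q is the neighbourhood of the
    parabola, or [false] if there is none. *)
Lemma sparse_cover f0 f1 f2 f3 e c b a c3 (d A L : int) (Q : int -> int -> bool) :
  polyf 6 c f0 -> polyf 5 b f1 -> polyf 4 a f2 -> polyf 2 c3 f3 -> 0 < a ->
  bounded_below (quartic f0 f1 f2 f3 e) ->
  d = 1 \/ d = 0 /\ (forall y, f3 y = c3 * y ^+ 2) -> 1 <= A -> 0 <= L ->
  (forall u y, ~~ Q u y -> u ^+ 2 * (y ^+ 4 + d * u ^+ 2) <=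
     A * (a * y ^+ 4 * u ^+ 2 + c3 * y ^+ 2 * u ^+ 3 + e * u ^+ 4)) ->
  sparse (fun v => exists u y,
    [/\ Q u y, L <= `|y| & v = quartic f0 f1 f2 f3 e u y]) ->
  sparse (fun v => exists u y, v = quartic f0 f1 f2 f3 e u y).
Proof.
move=> h0 h1 h2 h3 a0 bG hd A1 L0 hQ sQ.
have [M M0 sM] := strip_general h0 h1 h2 h3 a0 bG.
have [|N N0 sN] := sparse_outside (K := M + 1) h0 h1 h2 h3 hd A1 _ hQ; first by rewrite lerDr.
have rows := sparse_bigor_int (M + L + N) (fun y => sparse_row y bG).
apply: (sparse_sub _ (sparse_or (sparse_or rows sQ) (sparse_or sM sN))).
move=> v [u [y ->]]; have [le_y|lt_y] := lerP `|y| (M + L + N).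
  by left; left; exists y => //; exists u.
have [yM yL yN] : [/\ M <= `|y|, L <= `|y| & N <= `|y|].
  by clear -M0 L0 N0 lt_y; split; lia.
have [Quy|nQ] := boolP (Q u y); first by left; right; exists u, y.
right; have [le_u|lt_u] := lerP (M * `|u|) (y ^+ 2); first by left; exists u, y.
by right; exists u, y; split=> //; rewrite mulrDl mul1r (le_trans (ltW lt_u)) // lerDl.
Qed.

(** With z = 2 e u + g y^2, 4 e times the main part is u^2 z^2. Away from the parabola y^2 <= L |z|,
    and 2 e u = z - g y^2 then gives |u| <= (1 + |g| L) |z|. *)
Fact parabolic_main_term (a g e u y L : int) : 0 < e -> g ^+ 2 = 4 * a * e -> 0 <= L ->
  y ^+ 2 <= L * `|2 * e * u + g * y ^+ 2| ->
  u ^+ 2 * (y ^+ 4 + 1 * u ^+ 2) <= 4 * e * (L ^+ 2 + (1 + `|g| * L) ^+ 2) *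
    (a * y ^+ 4 * u ^+ 2 + g * y ^+ 2 * u ^+ 3 + e * u ^+ 4).
Proof.
move=> e0 disc L0 hy; rewrite mul1r; set z := 2 * e * u + _ in hy.
have -> : 4 * e * (L ^+ 2 + (1 + `|g| * L) ^+ 2) *
    (a * y ^+ 4 * u ^+ 2 + g * y ^+ 2 * u ^+ 3 + e * u ^+ 4) =
    u ^+ 2 * ((L ^+ 2 + (1 + `|g| * L) ^+ 2) *
      (z ^+ 2 + (4 * a * e - g ^+ 2) * y ^+ 4)) by rewrite /z; ring.
rewrite disc subrr mul0r addr0 ler_wpM2l ?sqr_ge0 // mulrDl -(real_normK (num_real z)).
have hu : `|u| <= (1 + `|g| * L) * `|z|.
  apply: le_trans (_ : `|2 * e * u| <= _).
    by rewrite normrM ler_peMl // ger0_norm; clear -e0; lia.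
  have -> : 2 * e * u = z - g * y ^+ 2 by rewrite /z; ring.
  apply: le_trans (ler_normB _ _) _; rewrite mulrDl mul1r lerD2l normrM -mulrA ler_wpM2l //.
  by rewrite ger0_norm // sqr_ge0.
apply: lerD; rewrite -exprMn.
  by rewrite (exprM y 2 2) ler_pXn2r ?nnegrE ?sqr_ge0 // mulr_ge0.
by rewrite -(real_normK (num_real u)) ler_pXn2r ?nnegrE // mulr_ge0 // addr_ge0 // mulr_ge0.
Qed.

(** * Sextics bounded below *)

Definition sextic (f : nat -> int -> int) (u y : int) : int :=
  \sum_(i < 7) f i y * u ^+ i.

Lemma polyf_sum_var f (y : int) n : (forall i, (n < i < 7)%N -> f i y = 0) ->
  (n < 7)%N -> polyf n (f n y) (fun u => sextic f u y).
Proof.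
move=> f0 n7; exists (\poly_(i < n.+1) f i y); split=> [||u]; first exact: size_poly.
  by rewrite coef_poly ltnSn.
rewrite horner_poly /sextic -(big_mkord xpredT (fun i => f i y * u ^+ i)) (@big_cat_nat _ _ _ n.+1) //=.
rewrite (@big_nat_cond _ _ _ n.+1) [X in _ + X]big1 ?addr0 ?big_mkord // => i.
by rewrite andbT => /f0 ->; rewrite mul0r.
Qed.

Lemma polyf_diagonal f0 f1 f2 f3 e c b a c3 (m : int) :
  polyf 6 c f0 -> polyf 5 b f1 -> polyf 4 a f2 -> polyf 2 c3 f3 ->
  polyf 6 (c + b * m + a * m ^+ 2) (fun k => quartic f0 f1 f2 f3 e (m * k) k).
Proof.
move=> h0 h1 h2 h3; have hm := polyf_scale m polyf_id.
apply: (polyf_eq (polyfD (polyfD (polyfD (polyfD h0 (polyfM h1 hm)) (polyfM h2 (polyfM hm hm)))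
   (polyf_wide (polyfM h3 (polyfM hm (polyfM hm hm)))))
   (polyf_wide (polyf_wide (polyfM (polyf_cst e) (polyfM hm (polyfM hm (polyfM hm hm)))))))).
  by ring.
by move=> k; rewrite /quartic; ring.
Qed.

(** Along u = m k, y = k the leading coefficient c + b m + a m^2 is nonnegative for every m, so a >=
    0. Along the parabola u = - 2 c3 e k^2, y = 2 e k the leading coefficient is 16 c3^2 e^5 (4 a e
    - c3^2). *)
Lemma quartic_main_terms_ge0 f0 f1 f2 f3 e c b a c3 :
  polyf 6 c f0 -> polyf 5 b f1 -> polyf 4 a f2 -> polyf 2 c3 f3 ->
  0 <= e -> bounded_below (quartic f0 f1 f2 f3 e) ->
  0 <= a /\ c3 ^+ 2 <= 4 * a * e.
Proof.
move=> h0 h1 h2 h3 e0 bG; have [D hD] := bG; have a0 : 0 <= a.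
  have nonneg m : 0 <= c + b * m + a * m ^+ 2.
    by apply: (polyf_lead_ge0 (polyf_diagonal e m h0 h1 h2 h3)) => k; apply: hD.
  apply: (@polyf_lead_ge0 1 a (fun m => c + b * m + a * m ^+ 2) 0) => //.
  apply: (polyf_eq (polyfD (polyf_wide (polyfD (polyf_wide (polyf_cst c)) (polyf_scale b polyf_id)))
     (polyf_scale a (polyfM polyf_id polyf_id)))); first by rewrite add0r !mulr1.
  by move=> m; ring.
split=> //; have [e00|e_neq0] := eqVneq e 0.
  rewrite e00 mulr0.
  have -> : c3 = 0; last by rewrite expr0n.
  (* With e = 0 every row is at most cubic in u, and an odd degree contradicts the lower bound. *)
  have f3_ge0 y : f3 y = 0.
    have hX := polyf_id.
    apply: (@polyf_odd_lead 3 _ (fun u => quartic f0 f1 f2 f3 e u y) D) => //.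
    apply: (polyf_eq (polyfD (polyfD (polyfD
        (polyf_wide (polyf_wide (polyf_wide (polyf_cst (f0 y)))))
        (polyf_wide (polyf_wide (polyf_scale (f1 y) hX))))
        (polyf_wide (polyf_scale (f2 y) (polyfM hX hX))))
        (polyf_scale (f3 y) (polyfM hX (polyfM hX hX))))); first by ring.
    by move=> u; rewrite /quartic e00; ring.
  apply/eqP; rewrite eq_le (polyf_lead_ge0 (D := 0) h3) => [|y]; last by rewrite f3_ge0.
  rewrite -oppr_ge0 -mulN1r andbT.
  by apply: (polyf_lead_ge0 (D := 0) (polyf_scale (- 1) h3)) => y; rewrite f3_ge0 mulr0.
have [-> |c3_neq0] := eqVneq c3 0; first by rewrite expr0n !mulr_ge0.
have hh : polyf 2 (- (2 * c3 * e)) (fun k => - (2 * c3 * e) * (k * k)).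
  by apply: polyf_eq (polyf_scale _ (polyfM polyf_id polyf_id)) _ _ => //; ring.
have [g0 [g1 [g2 [g3 [k0 _ _ _ gE]]]]] := quartic_transform (d := 0) (m := 2) (2 * e) 0
   (polyf_wide (polyf_wide h0)) (polyf_wide h1) h2 h3 (polyf_cst e) hh.
have bg : bounded_below (quartic g0 g1 g2 g3 e) by exists D => u y; rewrite gE.
have := bounded_below_lead k0 bg; rewrite /=; set lhs := (X in 0 <= X).
have -> : lhs = (16 * c3 ^+ 2 * e ^+ 5) * (4 * a * e - c3 ^+ 2) by rewrite /lhs; ring.
have c3_gt0 : 0 < c3 ^+ 2 by rewrite exprn_even_gt0.
have e5_gt0 : 0 < e ^+ 5 by rewrite exprn_gt0 // lt_neqAle eq_sym e_neq0.
by rewrite pmulr_rge0 ?subr_ge0 // mulr_gt0 // mulr_gt0.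
Qed.

(** The main part is u^2 times a form in u and y^2. If e = 0 it is a y^4 u^2; if c3^2 < 4 a e the
    form is definite; in both cases Q is [false]. Equality is the case of the parabola. *)
Lemma sparse_quartic f0 f1 f2 f3 e c b a c3 :
  polyf 6 c f0 -> polyf 5 b f1 -> polyf 4 a f2 -> polyf 2 c3 f3 ->
  a != 0 -> 0 <= e -> (e = 0 -> forall y, f3 y = 0) ->
  bounded_below (quartic f0 f1 f2 f3 e) ->
  sparse (fun v => exists u y, v = quartic f0 f1 f2 f3 e u y).
Proof.
move=> h0 h1 h2 h3 a_neq0 e_ge0 f30 bG.
have [a_ge0 disc] := quartic_main_terms_ge0 h0 h1 h2 h3 e_ge0 bG.
have a0 : 0 < a by rewrite lt_neqAle eq_sym a_neq0.
have none L : sparse (fun v => exists u y,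
    [/\ false, L <= `|y| & v = quartic f0 f1 f2 f3 e u y]).
  by exists 0%N => K K0; exists [::]; split=> // v [u [y []]].
have [e00|e_neq0] := eqVneq e 0.
  have c30 : c3 = 0.
    by apply/eqP; rewrite -sqrf_eq0 eq_le sqr_ge0 andbT; move: disc; rewrite e00 mulr0.
  apply: (@sparse_cover _ _ _ _ e c b a c3 0 1 0 (fun _ _ => false)) => //.
    by right; split=> // y; rewrite f30 // c30 mul0r.
  move=> u y _; rewrite c30 e00 !mul0r !addr0 mul1r mulrC ler_wpM2r ?sqr_ge0 //.
  by rewrite ler_peMl ?exprn_even_ge0 // -gtz0_ge1.
have e0 : 0 < e by rewrite lt_neqAle eq_sym e_neq0.
have [ltd|ged] := ltrP (c3 ^+ 2) (4 * a * e).
  apply: (@sparse_cover _ _ _ _ e c b a c3 1 (4 * (e + a)) 0 (fun _ _ => false)) => //.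
  - by left.
  - by clear -e0 a0; lia.
  move=> u y _; have -> : 4 * (e + a) * (a * y ^+ 4 * u ^+ 2 + c3 * y ^+ 2 * u ^+ 3 + e * u ^+ 4) =
    u ^+ 2 * (4 * (e + a) * (e * u ^+ 2 + c3 * u * y ^+ 2 + a * (y ^+ 2) ^+ 2)) by ring.
  rewrite ler_wpM2l ?sqr_ge0 // mul1r addrC (exprM y 2 2) binary_quadratic_definite //.
  by rewrite mulrAC.
have {ged disc} disc : c3 ^+ 2 = 4 * a * e by apply/eqP; rewrite eq_le disc.
have [L L0 sL] := parabolic_strip h0 h1 h2 h3 a0 e0 disc bG.
apply: (@sparse_cover _ _ _ _ e c b a c3 1 (4 * e * (L ^+ 2 + (1 + `|c3| * L) ^+ 2)) L
   (fun u y => L * `|2 * e * u + c3 * y ^+ 2| <= y ^+ 2)) => //.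
- by left.
- rewrite -gtz0_ge1 !mulr_gt0 // ltr_wpDl ?sqr_ge0 // exprn_gt0 // ltr_pwDl // mulr_ge0 //.
by move=> u y; rewrite -ltNge => /ltW h; apply: parabolic_main_term.
Qed.

(** On each row the highest power of u must be even with a nonnegative coefficient. This removes
    u^5, and makes the coefficient of u^4, which has degree at most 1 in y, a constant. *)
Lemma sparse_sextic (f : nat -> int -> int) (E : nat -> int) (D : int) :
  (forall i, (i < 7)%N -> polyf (6 - i) (E i) (f i)) ->
  (forall i, (2 < i < 7)%N -> E i = 0) -> E 2 != 0 ->
  (forall u y, D <= sextic f u y) ->
  sparse (fun v => exists u y, v = sextic f u y).
Proof.
move=> hf hE E2 hD.
have f6 y : f 6%N y = 0.
  have [p [sp p0 ->]] := hf 6%N isT.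
  by rewrite (size1_polyC sp) hornerC p0 hE.
have f5 y : f 5%N y = 0.
  apply: (@polyf_odd_lead 5 _ (fun u => sextic f u y) D) => //.
  by apply: polyf_sum_var => // -[|[|[|[|[|[|[|i]]]]]]] //.
have f4_ge0 y : 0 <= f 4%N y.
  apply: (@polyf_lead_ge0 3 _ (fun u => sextic f u y) D) => //.
  by apply: polyf_sum_var => // -[|[|[|[|[|[|[|i]]]]]]].
have f40 := hf 4%N isT; rewrite hE // in f40; have [c4 {}f40] := polyf_narrow f40.
have c40 : c4 = 0 by apply: polyf_odd_lead f40 f4_ge0.
rewrite c40 in f40; have [e {}f40] := polyf_narrow f40.
have f4E y : f 4%N y = e.
  by have [p [sp <- ->]] := f40; rewrite (size1_polyC sp) hornerC coefC.
have f3 y : e = 0 -> f 3%N y = 0.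
  move=> e0; apply: (@polyf_odd_lead 3 _ (fun u => sextic f u y) D) => //.
  by apply: polyf_sum_var => // -[|[|[|[|[|[|[|i]]]]]]] // _; rewrite f4E.
have f30 := hf 3%N isT; rewrite hE // in f30; have [c3 {}f30] := polyf_narrow f30.
have fE u y : sextic f u y = quartic (f 0%N) (f 1%N) (f 2%N) (f 3%N) e u y.
  rewrite /sextic !big_ord_recr big_ord0 /= f5 f6 f4E /quartic; ring.
apply: (sparse_sub _ (sparse_quartic (e := e) (hf 0%N isT) (hf 1%N isT) (hf 2%N isT) f30 E2 _ _ _)).
- by move=> v [u [y ->]]; exists u, y; rewrite fE.
- by rewrite -(f4E 0).
- by move=> e0 y; apply: f3.
by exists D => u y; rewrite -fE.
Qed.

(** * Binary polynomials under linear substitutions *)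

Definition mexp2 (i j : nat) : 'X_{1..2} := (U_(ord0) *+ i + U_(ord_max) *+ j)%MM.

Lemma mexp2E i j (m : 'X_{1..2}) :
  (mexp2 i j == m) = (i == m ord0) && (j == m ord_max).
Proof.
apply/eqP/andP => [<-|[/eqP -> /eqP ->]].
  by rewrite !mnmDE !mulmnE !mnm1E /= !mul1n !mul0n addn0 !eqxx.
apply/mnmP => k; rewrite mnmDE !mulmnE !mnm1E.
by case: (unliftP ord0 k) => [k' ->|->] /=; [rewrite !ord1 (_ : lift _ _ = ord_max) //=; [|exact: val_inj] |]; rewrite ?mul1n ?mul0n ?addn0.
Qed.

Lemma mdeg_mexp2 i j : mdeg (mexp2 i j) = (i + j)%N.
Proof. by rewrite mdegD !mdegMn !mdeg1 !mul1n. Qed.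

Lemma mdeg2E (m : 'X_{1..2}) : mdeg m = (m ord0 + m ord_max)%N.
Proof.
have /eqP {1}<- : mexp2 (m ord0) (m ord_max) == m by rewrite mexp2E !eqxx.
by rewrite mdeg_mexp2.
Qed.

(** The sum runs over a square of exponents, which is easier to handle than a triangle; the
    coefficients with i + j >= n are 0. *)
Lemma mpoly2E (K : comNzRingType) (P : {mpoly K[2]}) n : (msize P <= n)%N ->
  P = \sum_(i < n) \sum_(j < n) P@_(mexp2 i j) *: ('X_ord0 ^+ i * 'X_ord_max ^+ j).
Proof.
move=> sP; apply/mpolyP => m; rewrite raddf_sum /=.
under eq_bigr => i _.
  rewrite raddf_sum /=.
  under eq_bigr => j _ do rewrite mcoeffZ !mpolyXn -mpolyXD mcoeffX -/(mexp2 i j).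
  over.
have [lt_mn|le_nm] := ltnP (mdeg m) n; last first.
  have Pm : P@_m = 0 by apply: memN_msupp_eq0; apply: msize_mdeg_ge; apply: leq_trans le_nm.
  rewrite Pm big1 // => i _; rewrite big1 // => j _.
  by case: eqP => [->|_]; rewrite ?Pm ?mul0r ?mulr0.
have [lt0 lt1] : (m ord0 < n)%N /\ (m ord_max < n)%N.
  by move: lt_mn; rewrite mdeg2E => h; split; apply: leq_ltn_trans h; rewrite ?leq_addr ?leq_addl.
rewrite (bigD1 (Ordinal lt0)) //= (bigD1 (Ordinal lt1)) //= mexp2E !eqxx mulr1.
have /eqP -> : mexp2 (m ord0) (m ord_max) == m by rewrite mexp2E !eqxx.
rewrite !big1 ?addr0 // => [i|j] /negbTE ne; last by rewrite mexp2E -!val_eqE /= in ne *; rewrite ne andbF mulr0.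
by rewrite big1 // => j _; rewrite mexp2E -!val_eqE /= in ne *; rewrite ne mulr0.
Qed.

(** The linear form p X + r Y, dehomogenized at X = 1. *)
Definition lin (p r : int) : {poly int} := p%:P + r *: 'X.

Lemma coef_lin_mul p r (E : {poly int}) k :
  (lin p r * E)`_k = p * E`_k + (if k is k'.+1 then r * E`_k' else 0).
Proof. by rewrite mulrDl coefD coefCM -scalerAl coefZ coefXM; case: k => [|k]; rewrite ?mulr0. Qed.

Lemma size_lin_mul p r (E : {poly int}) d :
  (size E <= d.+1)%N -> (size (lin p r * E)%R <= d.+2)%N.
Proof.
move=> sE; apply/leq_sizeP => -[//|k] hk; rewrite coef_lin_mul !nth_default ?mulr0 ?addr0 //.
  exact: leq_trans sE _.
by apply: leq_trans sE _; apply: ltnW.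
Qed.

(** The target ring is arbitrary so that m and l can be integers as well as linear forms over
    [algC]. *)
Definition homogenize (A : comNzRingType) (d : nat) (E : {poly int}) (m l : A) : A :=
  \sum_(k < d.+1) (E`_k)%:~R * (m ^+ (d - k) * l ^+ k).

Lemma homogenize_lin_mul (A : comNzRingType) d (E : {poly int}) p r (m l : A) :
  (size E <= d.+1)%N ->
  homogenize d.+1 (lin p r * E) m l = (p%:~R * m + r%:~R * l) * homogenize d E m l.
Proof.
move=> sE; rewrite /homogenize.
under eq_bigr => k _ do rewrite coef_lin_mul intrD mulrDl.
rewrite big_split /= mulrDl; congr (_ + _).
  rewrite big_ord_recr /= nth_default // mulr0 mul0r addr0 mulr_sumr.
  apply: eq_bigr => k _; rewrite intrM subSn; last by rewrite -ltnS.
  by rewrite exprS; ring.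
rewrite big_ord_recl /= mul0r add0r mulr_sumr; apply: eq_bigr => k _.
rewrite /bump /= add1n subSS intrM exprS.
by ring.
Qed.

Lemma homogenize_monomial (A : comNzRingType) p q r s (m l : A) i j :
  (size (lin p r ^+ i * lin q s ^+ j)%R <= (i + j).+1)%N /\
  homogenize (i + j) (lin p r ^+ i * lin q s ^+ j) m l =
    (p%:~R * m + r%:~R * l) ^+ i * (q%:~R * m + s%:~R * l) ^+ j.
Proof.
elim: i => [|i [sE IHi]]; last first.
  rewrite !exprS -!mulrA addSn; split; first exact: size_lin_mul.
  by rewrite homogenize_lin_mul // IHi.
rewrite !expr0 !mul1r add0n; elim: j => [|j [sE IHj]]; last first.
  by rewrite !exprS; split; [exact: size_lin_mul | rewrite homogenize_lin_mul // IHj].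
by rewrite !expr0 size_poly1 /homogenize big_ord1 coef1 !expr0 !mulr1.
Qed.

(** The part of degree 6 after x = p X + r Y, y = q X + s Y, dehomogenized at X = 1: its coefficient
    of index k belongs to X^(6 - k) Y^k. *)
Definition top_form (c : nat -> nat -> int) p q r s : {poly int} :=
  \sum_(i < 7) \sum_(j < 7)
    (if (i + j == 6)%N then c i j else 0) *: (lin p r ^+ i * lin q s ^+ j).

Lemma size_top_form c p q r s : (size (top_form c p q r s) <= 7)%N.
Proof.
apply: (leq_trans (size_sum _ _ _)); apply/bigmax_leqP => i _.
apply: (leq_trans (size_sum _ _ _)); apply/bigmax_leqP => j _.
case: eqP => [ij|_]; last by rewrite scale0r size_poly0.
by apply: (leq_trans (size_scale_leq _ _)); have [+ _] := homogenize_monomial p q r s (0:int) 0 i j; rewrite ij.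
Qed.

Lemma homogenizeD (A : comNzRingType) d (E E' : {poly int}) (m l : A) :
  homogenize d (E + E') m l = homogenize d E m l + homogenize d E' m l.
Proof. by rewrite -big_split; apply: eq_bigr => k _; rewrite coefD intrD mulrDl. Qed.

Lemma homogenizeZ (A : comNzRingType) d (E : {poly int}) c (m l : A) :
  homogenize d (c *: E) m l = c%:~R * homogenize d E m l.
Proof. by rewrite mulr_sumr; apply: eq_bigr => k _; rewrite coefZ intrM mulrA. Qed.

Lemma homogenize0 (A : comNzRingType) d (m l : A) : homogenize d 0 m l = 0.
Proof. by rewrite /homogenize big1 // => k _; rewrite coef0 mul0r. Qed.

Lemma homogenize_top_form (A : comNzRingType) c p q r s (m l : A) :
  homogenize 6 (top_form c p q r s) m l =
  \sum_(i < 7) \sum_(j < 7) (if (i + j == 6)%N then c i j else 0)%:~R *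
    ((p%:~R * m + r%:~R * l) ^+ i * (q%:~R * m + s%:~R * l) ^+ j).
Proof.
rewrite /top_form (big_morph (fun E => homogenize 6 E m l)
  (fun E E' => homogenizeD 6 E E' m l) (homogenize0 6 m l)); apply: eq_bigr => i _.
rewrite (big_morph (fun E => homogenize 6 E m l)
  (fun E E' => homogenizeD 6 E E' m l) (homogenize0 6 m l)); apply: eq_bigr => j _.
rewrite homogenizeZ; case: eqP => [ij|_]; last by rewrite mulr0z !mul0r.
by have [_ <-] := homogenize_monomial p q r s m l i j; rewrite ij.
Qed.

(** E is the dehomogenized part of degree 6 of g, so its coefficient of index 6 - k belongs to X^k
    Y^(6 - k). *)
Definition sextic_rep (E : {poly int}) (g : int -> int -> int) : Prop :=
  exists f : nat -> {poly int},
    (forall k, (k < 7)%N -> (size (f k) <= 7 - k)%N /\ (f k)`_(6 - k) = E`_(6 - k)) /\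
    forall X Y, g X Y = sextic (fun k => horner (f k)) X Y.

Lemma sextic_rep_homogenize d (E : {poly int}) : (d <= 6)%N ->
  sextic_rep (if d == 6%N then E else 0) (fun X Y => homogenize d E X Y).
Proof.
move=> d6; exists (fun k => if (k <= d)%N then E`_(d - k) *: 'X^(d - k) else 0); split=> [k k7|X Y].
  case: (leqP k d) => [kd|dk]; last first.
    by rewrite size_poly0 coef0; split=> //; case: eqP => [d6'|_]; [lia | rewrite coef0].
  split; first by rewrite (leq_trans (size_scale_leq _ _)) // size_polyXn; lia.
  rewrite coefZ coefXn; have [->|ne] := eqVneq d 6%N; first by rewrite eqxx mulr1.
  by rewrite coef0 (_ : (6 - k == d - k)%N = false) ?mulr0 //; apply/eqP; lia.
rewrite /homogenize (reindex_inj rev_ord_inj) /= /sextic.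
rewrite (big_ord_widen 7 (fun k : nat => (E`_(d.+1 - k.+1)%N)%:~R * (X ^+ (d - (d.+1 - k.+1)) * Y ^+ (d.+1 - k.+1)))) //.
rewrite big_mkcond /=; apply: eq_bigr => k _; rewrite ltnS subSS.
case: (leqP k d) => [kd|_]; last by rewrite horner0 mul0r.
by rewrite hornerZ hornerXn subKn // intz -mulrA (mulrC (X ^+ _)).
Qed.

Lemma sextic_repD E E' g g' : sextic_rep E g -> sextic_rep E' g' ->
  sextic_rep (E + E') (fun X Y => g X Y + g' X Y).
Proof.
move=> [f [hf gE]] [f' [hf' gE']]; exists (fun k => f k + f' k); split=> [k k7|X Y].
  have [s1 c1] := hf k k7; have [s2 c2] := hf' k k7.
  by rewrite !coefD c1 c2 (leq_trans (size_polyD _ _)) // geq_max s1.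
by rewrite gE gE' -big_split; apply: eq_bigr => k _; rewrite hornerD mulrDl.
Qed.

Lemma sextic_repZ a E g : sextic_rep E g -> sextic_rep (a *: E) (fun X Y => a * g X Y).
Proof.
move=> [f [hf gE]]; exists (fun k => a *: f k); split=> [k k7|X Y].
  have [s1 c1] := hf k k7.
  by rewrite !coefZ c1 (leq_trans (size_scale_leq _ _)).
by rewrite gE mulr_sumr; apply: eq_bigr => k _; rewrite hornerZ mulrA.
Qed.

Lemma sextic_rep0 : sextic_rep 0 (fun _ _ => 0).
Proof.
exists (fun=> 0); split=> [k k7|X Y]; first by rewrite size_poly0 !coef0.
by rewrite /sextic big1 // => k _; rewrite horner0 mul0r.
Qed.

Lemma sextic_rep_sum n (E : 'I_n -> {poly int}) g :
  (forall i, sextic_rep (E i) (g i)) ->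
  sextic_rep (\sum_i E i) (fun X Y => \sum_i g i X Y).
Proof.
move=> h; elim: n E g h => [|n IHn] E g h.
  have [f [hf gE]] := sextic_rep0; exists f; rewrite big_ord0; split=> // X Y.
  by rewrite big_ord0 (gE X Y).
have [f [hf gE]] := sextic_repD (IHn _ _ (fun i => h (widen_ord (leqnSn n) i))) (h ord_max).
by exists f; split=> [|X Y]; rewrite big_ord_recr //= -(gE X Y).
Qed.

Lemma sextic_rep_eq E g g' : sextic_rep E g -> (forall X Y, g X Y = g' X Y) -> sextic_rep E g'.
Proof. by move=> [f [hf gE]] h; exists f; split=> // X Y; rewrite -h. Qed.

Lemma sextic_rep_top_form (c : nat -> nat -> int) p q r s :
  (forall i j, (6 < i + j)%N -> c i j = 0) ->
  sextic_rep (top_form c p q r s) (fun X Y => \sum_(i < 7) \sum_(j < 7)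
     c i j * ((p * X + r * Y) ^+ i * (q * X + s * Y) ^+ j)).
Proof.
move=> hc; apply: sextic_rep_sum => i; apply: sextic_rep_sum => j.
have [_ hE] := homogenize_monomial p q r s (0 : int) 0 i j.
have [ltij|leij] := ltnP 6 (i + j).
  rewrite hc // gtn_eqF // scale0r; apply: (sextic_rep_eq sextic_rep0) => X Y.
  by rewrite mul0r.
have := sextic_repZ (c i j) (sextic_rep_homogenize (lin p r ^+ i * lin q s ^+ j) leij).
case: eqP => _; rewrite ?scaler0 ?scale0r => h; apply: (sextic_rep_eq h) => X Y;
  by have [_ ->] := homogenize_monomial p q r s X Y i j; rewrite !intz.
Qed.

Lemma mcoeff_pihomog (K : comNzRingType) n (mf : measure n) d (p : {mpoly K[n]}) m :
  (pihomog mf d p)@_m = if mf m == d then p@_m else 0.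
Proof.
rewrite pihomogE raddf_sum /= big_mkcond /= [in RHS](mpolyE p) raddf_sum /=.
rewrite (eq_bigr (fun m' => if mf m == d then (p@_m' *: 'X_[m'])@_m else 0)).
  by case: ifP => // _; rewrite big1.
move=> m' _; rewrite mcoeffZ mcoeffX; case: (eqVneq m' m) => [-> //|_].
by rewrite mulr0 !if_same.
Qed.

(** * Rationality of the fourfold root *)

(** A double root z would be a root of the derivative of p, which is nonzero in characteristic 0 and
    has too small a degree to be divisible by p. *)
Lemma mup_minpoly (p : {poly rat}) (z : algC) :
  p \is monic -> (forall q, root (map_poly ratr q) z = (p %| q)) ->
  mup z (map_poly ratr p : {poly algC}) = 1%N.
Proof.
move=> pm pz; have p0 : p != 0 by apply: monic_neq0.
have P0 : (map_poly ratr p : {poly algC}) != 0 by rewrite map_poly_eq0.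
have rp : root (map_poly ratr p) z by rewrite pz.
apply/eqP; rewrite eqn_leq mup_geq // expr1 dvdp_XsubCl rp andbT mup_leq //.
apply/negP => /dvdpP[q /(congr1 (fun f => f^`()))]; rewrite deriv_map => e.
have : root (map_poly ratr p^`()) z.
  by rewrite e expr2 mulrA derivM rootE !hornerE subrr !mulr0 mul0r addr0.
have sp : (1 < size p)%N.
  rewrite ltnNge; apply/negP => /size1_polyC pc; move: rp p0; rewrite pc map_polyC rootC.
  by rewrite fmorph_eq0 polyC_eq0 => /eqP ->; rewrite eqxx.
have dp0 : p^`() != 0.
  apply/eqP => d0; have := coef_deriv p (size p).-2; rewrite d0 coef0.
  have -> : ((size p).-2.+1 = (size p).-1)%N by case: (size p) sp => [|[]].
  by rewrite -lead_coefE (monicP pm) => /eqP; rewrite eq_sym pnatr_eq0; case: (size p) sp => [|[]].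
rewrite pz => /(dvdp_leq dp0); rewrite leqNgt lt_size_deriv //.
Qed.

(* The minimal polynomial of the root divides to the fourth power, so it has
   degree at most [6 / 4]. *)
Lemma rational_fourfold_root (B : {poly int}) (R : {poly algC}) (z : algC) :
  B != 0 -> (size B <= 7)%N -> map_poly intr B = R * ('X - z%:P) ^+ 4 ->
  exists x : rat, z = ratr x.
Proof.
move=> B0 sB BE; have [p [_ pm pz]] := minCpolyP z.
pose Bq : {poly rat} := map_poly intr B.
have BqE : map_poly ratr Bq = R * ('X - z%:P) ^+ 4.
  by rewrite -BE -map_poly_comp; apply: eq_map_poly => x /=; rewrite ratr_int.
have Bq0 : Bq != 0 by rewrite map_poly_eq0_id0 ?intr_eq0 ?lead_coef_eq0.
have muB : (4 <= mup z (map_poly ratr Bq : {poly algC}))%N.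
  by rewrite mup_geq ?map_poly_eq0 // BqE dvdp_mull.
have mu1 := mup_minpoly pm pz; have p0 : p != 0 by apply: monic_neq0.
have mu_exp k : mup z (map_poly ratr (p ^+ k) : {poly algC}) = k.
  elim: k => [|k IHk]; first by rewrite expr0 rmorph1 mupNroot // root1.
  by rewrite exprS rmorphM mupM ?map_poly_eq0 ?expf_neq0 // IHk mu1.
(* Since z is a simple root of p, the quotient by p^k still vanishes at z for k < 4, so p divides it
   once more. *)
have dvd k : (k <= 4)%N -> p ^+ k %| Bq.
  elim: k => [_|k IHk k4]; first by rewrite expr0 dvd1p.
  have /dvdpP[A AE] := IHk (ltnW k4).
  have A0 : A != 0 by apply: contra_neq Bq0 => A0; rewrite AE A0 mul0r.
  rewrite AE exprS dvdp_mul //.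
  move: muB; rewrite AE rmorphM mupM ?map_poly_eq0 ?expf_neq0 // mu_exp => h.
  rewrite -pz -dvdp_XsubCl XsubC_dvd ?map_poly_eq0 // lt0n.
  by apply: contraL h => /eqP ->; rewrite add0n -ltnNge.
have := dvdp_leq Bq0 (dvd 4 isT).
rewrite size_map_inj_poly; [|exact: intr_inj|by []] => h.
have sp4 : (((size p).-1 * 4).+1 = size (p ^+ 4))%N by rewrite -size_exp prednK // size_poly_gt0 expf_neq0.
rewrite -sp4 in h.
have rp : root (map_poly ratr p) z by rewrite pz.
have sp : size p = 2%N.
  have : ((size p).-1 * 4 < 7)%N by apply: leq_trans h sB.
  have : size p != 0%N by rewrite size_poly_eq0.
  have : size p != 1%N.
    apply/negP => /eqP s1; move: rp p0; rewrite (size1_polyC (eq_leq s1)) map_polyC rootC.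
    by rewrite fmorph_eq0 polyC_eq0 => /eqP ->; rewrite eqxx.
  by case: (size p) => [|[|[|n]]] //; lia.
exists (- p`_0); move: rp; rewrite rootE (horner_coef_wide _ (n := 2)); last first.
  by rewrite (leq_trans (size_poly _ _)) ?sp.
rewrite big_ord_recr big_ord1 /= !coef_map /= expr0 expr1 mulr1.
have -> : p`_1 = 1 by move/monicP: pm; rewrite lead_coefE sp.
by rewrite rmorph1 mul1r rmorphN addrC addr_eq0 => /eqP.
Qed.

(** * The part of degree 6 in unimodular coordinates *)

Fact unimodular_inverse (A : comNzRingType) (p q r s x y : A) : p * s - q * r = 1 ->
  p * (s * x - r * y) + r * (p * y - q * x) = x /\
  q * (s * x - r * y) + s * (p * y - q * x) = y.
Proof.
move=> det; split; [rewrite -[RHS]mul1r -det | rewrite -[RHS]mul1r -det]; by ring.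
Qed.

Lemma mpoly_top_form (P : {mpoly algC[2]}) (c : nat -> nat -> int) (p q r s : int) :
  P = \sum_(i < 7) \sum_(j < 7)
    (if (i + j == 6)%N then c i j else 0)%:~R *: ('X_ord0 ^+ i * 'X_ord_max ^+ j) ->
  p * s - q * r = 1 ->
  P = homogenize 6 (top_form c p q r s)
        (s%:~R * 'X_ord0 - r%:~R * 'X_ord_max) (p%:~R * 'X_ord_max - q%:~R * 'X_ord0).
Proof.
move=> -> det; rewrite homogenize_top_form; apply: eq_bigr => i _; apply: eq_bigr => j _.
have det' : (p%:~R * s%:~R - q%:~R * r%:~R : {mpoly algC[2]}) = 1.
  by rewrite -!intrM -intrB det.
have [e0 e1] := unimodular_inverse 'X_ord0 'X_ord_max det'.
by rewrite e0 e1 scaler_int mulrzl.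
Qed.

(** Substituting [lin p r] and [lin q s] turns a factorization of P over [algC] into one of an
    integer polynomial in one variable. *)
Lemma mmap_top_form (P : {mpoly algC[2]}) (c : nat -> nat -> int) (p q r s : int)
    (u v : {poly algC}) :
  P = \sum_(i < 7) \sum_(j < 7)
    (if (i + j == 6)%N then c i j else 0)%:~R *: ('X_ord0 ^+ i * 'X_ord_max ^+ j) ->
  u = map_poly intr (lin p r) -> v = map_poly intr (lin q s) ->
  mmap polyC (tnth [tuple u; v]) P = map_poly intr (top_form c p q r s).
Proof.
move=> -> -> ->; rewrite !rmorph_sum /=; apply: eq_bigr => i _.
rewrite !rmorph_sum /=; apply: eq_bigr => j _.
by rewrite mmapZ rmorphM !rmorphXn /= !mmapX !mmap1U -mul_polyC !rmorphM !rmorphXn /= map_polyC.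
Qed.

Lemma linear_formE (K : comNzRingType) (H : {mpoly K[2]}) :
  H \is homog mdeg -> msize H = 2%N ->
  exists a b : K, H = a *: 'X_ord0 + b *: 'X_ord_max.
Proof.
move=> hH sH; exists H@_(mexp2 1 0), H@_(mexp2 0 1).
have c00 : H@_(mexp2 0 0) = 0.
  move: hH; rewrite homog_msize sH => hH.
  apply: (dhomog_nemf_coeff hH); change (mdeg (mexp2 0 0) != 1%N).
  by rewrite mdeg_mexp2.
have c11 : H@_(mexp2 1 1) = 0.
  by apply: memN_msupp_eq0; apply: msize_mdeg_ge; rewrite sH mdeg_mexp2.
rewrite [LHS](@mpoly2E _ _ 2) ?sH // !big_ord_recl !big_ord0 /= /bump /= !addn0 c00 c11.
by rewrite !expr0 !expr1 !scale0r !mul1r !mulr1 !add0r !addr0 addrC.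
Qed.

Lemma homogeneous_part_coef (F : {mpoly int[2]}) d m :
  (to_algC (homogeneous_part d F))@_m = (if mdeg m == d then F@_m else 0)%:~R.
Proof. by rewrite /to_algC mcoeff_map_mpoly mcoeff_pihomog. Qed.

Lemma homogeneous_part6E (F : {mpoly int[2]}) : to_algC (homogeneous_part 6 F) =
  \sum_(i < 7) \sum_(j < 7) (if (i + j == 6)%N then F@_(mexp2 i j) else 0)%:~R
    *: ('X_ord0 ^+ i * 'X_ord_max ^+ j).
Proof.
rewrite [LHS](@mpoly2E _ _ 7) => [|].
  by apply: eq_bigr => i _; apply: eq_bigr => j _; rewrite homogeneous_part_coef mdeg_mexp2.
rewrite msizeE; apply/bigmax_leqP_seq => m; rewrite mcoeff_msupp homogeneous_part_coef.
by case: (eqVneq (mdeg m) 6%N) => [-> //|_]; rewrite eqxx.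
Qed.

Lemma homogeneous_part6_neq0 (F : {mpoly int[2]}) :
  msize F = 7%N -> to_algC (homogeneous_part 6 F) != 0.
Proof.
move=> sF; have F0 : F != 0 by apply/eqP => F0; move: sF; rewrite F0 msize0.
apply: contraTneq isT => /(congr1 (mcoeff (mlead F))); rewrite mcoeff0 homogeneous_part_coef.
have -> : mdeg (mlead F) = 6%N by apply/eqP; rewrite -eqSS mlead_deg // sF.
by move/eqP; rewrite eqxx intr_eq0 mleadc_eq0 (negbTE F0).
Qed.

Lemma homogeneous_part6_top_form (F : {mpoly int[2]}) p q r s : p * s - q * r = 1 ->
  to_algC (homogeneous_part 6 F) = homogenize 6 (top_form (fun i j => F@_(mexp2 i j)) p q r s)
        (s%:~R * 'X_ord0 - r%:~R * 'X_ord_max) (p%:~R * 'X_ord_max - q%:~R * 'X_ord0).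
Proof. exact: (@mpoly_top_form _ (fun i j => F@_(mexp2 i j)) _ _ _ _ (homogeneous_part6E F)). Qed.

Lemma homogeneous_part6_mmap (F : {mpoly int[2]}) p q r s (u v : {poly algC}) :
  u = map_poly intr (lin p r) -> v = map_poly intr (lin q s) ->
  mmap polyC (tnth [tuple u; v]) (to_algC (homogeneous_part 6 F)) =
  map_poly intr (top_form (fun i j => F@_(mexp2 i j)) p q r s).
Proof. exact: (@mmap_top_form _ (fun i j => F@_(mexp2 i j)) _ _ _ _ _ _ (homogeneous_part6E F)). Qed.

Lemma top_form_neq0 (F : {mpoly int[2]}) p q r s :
  msize F = 7%N -> p * s - q * r = 1 ->
  top_form (fun i j => F@_(mexp2 i j)) p q r s != 0.
Proof.
move=> sF det; apply/eqP => t0; have := homogeneous_part6_neq0 sF.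
by rewrite (homogeneous_part6_top_form F det) t0 homogenize0 eqxx.
Qed.

Lemma mmap_linear (u v : {poly algC}) (a b : algC) :
  mmap polyC (tnth [tuple u; v]) (a *: 'X_ord0 + b *: 'X_ord_max) = a *: u + b *: v.
Proof. by rewrite rmorphD /= !mmapZ !mmapX !mmap1U !mul_polyC. Qed.

(** Degrees add up, and 4 deg H <= 6 leaves only degree 1. *)
Lemma fourth_power_linear (P Q H : {mpoly algC[2]}) :
  (msize P <= 7)%N -> P != 0 -> P = Q * H ^+ 4 -> (1 < msize H)%N -> msize H = 2%N.
Proof.
move=> sP P0 PE H1; have H0 : H != 0 by apply/eqP => H0; move: H1; rewrite H0 msize0.
have Q0 : Q != 0 by apply: contra_neq P0 => Q0; rewrite PE Q0 mul0r.
have sQ : (0 < msize Q)%N by rewrite lt0n msize_poly_eq0.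
move: sP; rewrite PE !exprS expr0 mulr1 !msizeM ?mulf_neq0 //.
move: (msize Q) (msize H) sQ H1 => x y x0 y1; clear -x0 y1; lia.
Qed.

(** The zero line of H is spanned by a primitive integer vector (p, q), which is completed to a
    unimodular basis. *)
Lemma rational_direction (F : {mpoly int[2]}) (Q H : {mpoly algC[2]}) (a b : algC) :
  msize F = 7%N -> H = a *: 'X_ord0 + b *: 'X_ord_max ->
  to_algC (homogeneous_part 6 F) = Q * H ^+ 4 ->
  exists p q r s : int, p * s - q * r = 1 /\
    exists t : algC, H = (t * q%:~R) *: 'X_ord0 + (- (t * p%:~R)) *: 'X_ord_max.
Proof.
move=> sF HE PE; have [a0|a_neq0] := eqVneq a 0.
  exists 1, 0, 0, 1; split=> //; exists (- b).
  by rewrite HE a0 mulr0 mulr1 opprK.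
(* The substitution x = - T, y = 1 sends H to - a (T - b / a), so b / a is a fourfold root of B. *)
pose B := top_form (fun i j => F@_(mexp2 i j)) 0 1 (-1) 0.
have B0 : B != 0 by apply: top_form_neq0.
have uE : - 'X = map_poly intr (lin 0 (-1)) :> {poly algC}.
  by rewrite rmorphD /= map_polyC /= map_polyZ /= map_polyX scaleN1r add0r.
have vE : 1 = map_poly intr (lin 1 0) :> {poly algC}.
  by rewrite rmorphD /= map_polyC /= scale0r rmorph0 addr0.
have := homogeneous_part6_mmap F uE vE.
rewrite PE rmorphM rmorphXn /= HE mmap_linear => BE.
set R := mmap _ _ Q in BE.
have [x xE] : exists x : rat, b / a = ratr x.
  apply: (@rational_fourfold_root B (R * ((- a) ^+ 4)%:P)) => //; first exact: size_top_form.
  rewrite -BE -mulrA polyC_exp -exprMn; congr (_ * _ ^+ _).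
  rewrite mulrBr -polyCM mulNr (mulrCA a) mulfV // mulr1 !polyCN opprK.
  by rewrite mulNr scalerN -!mul_polyC mulr1.
have [u [v uv]] := Bezoutz (numq x) (denq x).
have cop : gcdz (numq x) (denq x) = 1 by apply/eqP; rewrite -[_ == _]/(coprimez _ _) coprimezE coprime_num_den.
(* With b / a = n / d in lowest terms, H is a multiple of d x + n y; the Bezout coefficients of n
   and d give the determinant 1. *)
exists (- numq x), (denq x), (- v), (- u); split; first by rewrite -cop -uv; ring.
have d0 : (denq x)%:~R != 0 :> algC by rewrite intr_eq0 denq_neq0.
exists (a / (denq x)%:~R); rewrite mulfVK //; congr (_ + _ *: _).
rewrite rmorphN mulrN opprK mulrAC -mulrA -/(ratr x) -xE.
by rewrite mulrCA mulfV // mulr1.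
Qed.

(** Only the terms of index 5 and 6 survive, and both contain the fifth power of the form Y = p y -
    q x. *)
Lemma fifth_power_of_top_form (F : {mpoly int[2]}) p q r s :
  p * s - q * r = 1 ->
  (forall k, (k < 5)%N -> (top_form (fun i j => F@_(mexp2 i j)) p q r s)`_k = 0) ->
  divisible_by_form_power 5 (to_algC (homogeneous_part 6 F)).
Proof.
move=> det t0; rewrite (homogeneous_part6_top_form F det).
set t := top_form _ p q r s in t0 *.
set m := s%:~R * 'X_ord0 - _; set l := p%:~R * 'X_ord_max - _.
have tz k : (k < 5)%N -> (t`_k)%:~R = 0 :> {mpoly algC[2]} by move=> /t0 ->.
exists l; split; last first.
  exists ((t`_5)%:~R * m + (t`_6)%:~R * l).
  rewrite /homogenize !big_ord_recr big_ord0 /=.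
  rewrite (tz 0%N) // (tz 1%N) // (tz 2%N) // (tz 3%N) // (tz 4%N) //.
  have [-> ->] : (6 - 5 = 1 /\ 6 - 6 = 0)%N by [].
  by move: (t`_5)%:~R (t`_6)%:~R m l => a b m l; ring.
have lE : l = p%:~R *: 'X_ord_max - q%:~R *: 'X_ord0 by rewrite /l !scaler_int !mulrzl.
have lc i : l@_U_(i) = p%:~R * (ord_max == i)%:R - q%:~R * (ord0 == i)%:R.
  by rewrite lE mcoeffB !mcoeffZ !mcoeffXU.
have l_neq0 : l != 0.
  apply/eqP => l0; have := lc ord0; have := lc ord_max.
  rewrite l0 !mcoeff0 /= !mulr1 !mulr0 subr0 sub0r => /esym/eqP.
  rewrite intr_eq0 => /eqP p0 /esym/eqP; rewrite oppr_eq0 intr_eq0 => /eqP q0.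
  by move: det; rewrite p0 q0 !mul0r.
have l_hom : l \is 1.-homog.
  by rewrite lE rpredB // rpredZ // dhomogX; apply/eqP; apply: mdeg1.
have l_hom' : l \is homog mdeg by apply/homogP; exists 1%N.
split=> //; move: l_hom'; rewrite homog_msize => h.
by have := dhomog_uniq l_neq0 l_hom h; case: (msize l) => [|[|n]].
Qed.

(** In the coordinates given by the zero line of H, the form H is - t Y; hence the dehomogenized
    part of degree 6 is a multiple of the fourth power of the variable. *)
Lemma divisible_by_fourth_power_frame (F : {mpoly int[2]}) :
  msize F = 7%N ->
  divisible_by_form_power 4 (to_algC (homogeneous_part 6 F)) ->
  exists p q r s : int, p * s - q * r = 1 /\
    forall k, (k < 4)%N -> (top_form (fun i j => F@_(mexp2 i j)) p q r s)`_k = 0.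
Proof.
move=> sF [H [[hH H1] [Q PE]]]; have P0 := homogeneous_part6_neq0 sF.
have sP : (msize (to_algC (homogeneous_part 6 F)) <= 7)%N.
  rewrite msizeE; apply/bigmax_leqP_seq => m; rewrite mcoeff_msupp homogeneous_part_coef.
  by case: (eqVneq (mdeg m) 6%N) => [-> //|_]; rewrite eqxx.
have [a [b HE]] := linear_formE hH (fourth_power_linear sP P0 PE H1).
have [p [q [r [s [det [t Ht]]]]]] := rational_direction sF HE PE.
exists p, q, r, s; split=> // k k4.
have := homogeneous_part6_mmap F (erefl (map_poly intr (lin p r)))
  (erefl (map_poly intr (lin q s))).
rewrite PE rmorphM rmorphXn /= Ht mmap_linear.
have -> : (t * q%:~R) *: map_poly intr (lin p r) + - (t * p%:~R) *: map_poly intr (lin q s)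
    = - t *: 'X :> {poly algC}.
  have lE x y : map_poly intr (lin x y) = (x%:~R)%:P + y%:~R *: 'X :> {poly algC}.
    by rewrite rmorphD /= map_polyC map_polyZ map_polyX.
  have det' : p%:~R * s%:~R - q%:~R * r%:~R = 1 :> algC by rewrite -!intrM -intrB det.
  have detX : (q%:~R * r%:~R - p%:~R * s%:~R)%:P = -1 :> {poly algC}.
    by rewrite -opprB det' polyCN.
  move: detX; rewrite !lE polyCB !polyCM -!mul_polyC !polyCN !polyCM.
  move: (p%:~R)%:P (q%:~R)%:P (r%:~R)%:P (s%:~R)%:P t%:P 'X => x y z w t' X h.
  by rewrite -[RHS]mulr1 -[1]opprK -h; ring.
rewrite exprZn -scalerAr => /(congr1 (fun f : {poly algC} => f`_k)).
rewrite coefZ coefMXn k4 mulr0 coef_map_id0 // => /esym/eqP.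
by rewrite intr_eq0 => /eqP.
Qed.

Lemma eval2_sum (F : {mpoly int[2]}) (x y : int) : (msize F <= 7)%N ->
  eval2 F x y = \sum_(i < 7) \sum_(j < 7) F@_(mexp2 i j) * (x ^+ i * y ^+ j).
Proof.
move=> sF; rewrite /eval2 {1}(mpoly2E sF) rmorph_sum /=; apply: eq_bigr => i _.
rewrite rmorph_sum /=; apply: eq_bigr => j _.
by rewrite mevalZ rmorphM !rmorphXn /= !mevalXU.
Qed.

Theorem proposition1p8 (F : {mpoly int[2]})
    (degF : msize F = 7%N)
    (div4 : divisible_by_form_power 4 (to_algC (homogeneous_part 6 F)))
    (ndiv5 : ~ divisible_by_form_power 5 (to_algC (homogeneous_part 6 F))) :
  ~ arithmetically_complete F.
Proof.
move=> [D1 [D2 [D1_gt0 hF]]].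
have [p [q [r [s [det top0]]]]] := divisible_by_fourth_power_frame degF div4.
(* The form is now Y^4 (a X^2 + b X Y + c Y^2), with a the coefficient of index 4 of t. *)
set t := top_form _ p q r s in top0.
have t4 : t`_4 != 0.
  apply/eqP => t4; apply: ndiv5; apply: (fifth_power_of_top_form det) => k.
  by rewrite ltnS leq_eqVlt => /orP[/eqP -> //|]; apply: top0.
have [|f [hf fE]] := @sextic_rep_top_form (fun i j => F@_(mexp2 i j)) p q r s.
  by move=> i j ij; apply: memN_msupp_eq0; apply: msize_mdeg_ge; rewrite degF mdeg_mexp2.
have GE X Y : sextic (fun k => horner (f k)) X Y = eval2 F (p * X + r * Y) (q * X + s * Y).
  by rewrite -fE eval2_sum // degF.
have bG X Y : D2 <= sextic (fun k => horner (f k)) X Y.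
  have [+ _] := hF (sextic (fun k => horner (f k)) X Y).
  case; first by rewrite GE; eexists; eexists.
  by move=> m [m0 ->]; rewrite lerDr mulr_ge0 // ltW.
have sG := sparse_sextic (E := fun k => t`_(6 - k)) _ _ t4 bG.
apply: (sparse_not_progression D1_gt0 (sG _ _)) => [i i7|i|m m0].
- by have [sf ft] := hf i i7; exists (f i); split=> //; rewrite -subSn.
- by move=> /andP[i2 i7]; apply: top0; lia.
have [_ /(_ (ex_intro _ m (conj m0 erefl)))[x [y xy]]] := hF (D1 * m + D2).
(* The inverse substitution is integral, so every value of F is a value of the transformed
   polynomial. *)
exists (s * x - r * y), (p * y - q * x).
have [e0 e1] := unimodular_inverse x y det.
by rewrite GE e0 e1 xy.
Qed.
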